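(* Let $\beta\in(1,2)$ and $t=\frac{\log(2/\beta)}{\log 2}$. The set $\mathcal E_\beta(x)$ of $\beta$-expansions of $x$ has positive $t$-dimensional Hausdorff measure for Lebesgue almost every $x\in I_\beta$ if and only if the Bernoulli convolution $\nu_\beta$ is absolutely continuous with bounded density. In this case, for almost every $x\in I_\beta$, the normalised Hausdorff measure on $\mathcal E_\beta(x)$, $A\mapsto \mathcal H^t(A)/\mathcal H^t(\mathcal E_\beta(x))$ for $A\subset\mathcal E_\beta(x)$, coincides with the measure $m_x$.
   Context: $\Sigma=\{0,1\}^{\mathbb N}$ is endowed with the metric $d(\underline a,\underline b)=2^{-\sup\{n:a_1\cdots a_n=b_1\cdots b_n\}}$ if $a_1=b_1$ and $d(\underline a,\underline b)=1$ otherwise; $\mathcal H^t$ is $t$-dimensional Hausdorff measure for this metric. $m$ is the $(\frac12,\frac12)$ Bernoulli measure on $\Sigma$. $I_\beta=[0,\frac1{\beta-1}]$, $\pi_\beta:\Sigma\to I_\beta$, $\pi_\beta(\underline a)=\sum_{i\ge1}a_i\beta^{-i}$, and $\mathcal E_\beta(x)=\pi_\beta^{-1}(x)$. The Bernoulli convolution is $\nu_\beta=m\circ\pi_\beta^{-1}$. ''Absolutely continuous'' means with respect to Lebesgue measure; ''bounded density'' means essentially bounded density. The family $(m_x)$ is the $\nu_\beta$-almost everywhere unique family of probability measures such that $m_x$ is supported on $\mathcal E_\beta(x)$ and, for every integrable $f:\Sigma\to\mathbb R$, $$\int_\Sigma f\,dm=\int_{I_\beta}\int_{\mathcal E_\beta(x)}f(\underline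 a)\,dm_x(\underline a)\,d\nu_\beta(x).$$ *)

(* Defs.v *)
From HB Require Import structures.
From mathcomp Require Import all_boot all_order all_algebra.
From mathcomp Require Import all_classical all_reals all_analysis measurable_realfun ess_sup_inf.

Set Implicit Arguments.
Unset Strict Implicit.
Unset Printing Implicit Defensive.

Import Order.TTheory GRing.Theory Num.Theory.
Import numFieldNormedType.Exports.

Local Open Scope classical_set_scope.
Local Open Scope ring_scope.

(* Sequences are indexed from 0: [a i] is the digit usually written a_(i+1). *)
Definition cylinder (w : seq bool) : set (nat -> bool) :=
  [set a | forall i, (i < size w)%N -> a i = nth false w i].

(* {0,1}^N with its Borel sigma-algebra, which is generated by the cylinders. *)
Notation Sigma := (g_sigma_algebraType (range cylinder)).

Section HausdorffMeasure.
Context {R : realType} {T : Type}.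
Variable d : T -> T -> R.

(* The added point 0 only matters for the empty set, whose diameter is 0. *)
Definition diam (A : set T) : \bar R :=
  ereal_sup ([set 0%E] `|` [set (d x y)%:E | x in A & y in A]).

(* Finite covers are included by padding with set0; as
   0 `^ t = 0 only for t != 0, these definitions are meant for t > 0. *)
Definition hausdorff_premeasure (t : R) (delta : R) (A : set T) : \bar R :=
  ereal_inf [set (\sum_(0 <= i <oo) (diam (U i) `^ t))%E | U in
    [set U : nat -> set T |
      A `<=` \bigcup_i U i /\ forall i, (diam (U i) <= delta%:E)%E]].

Definition hausdorff_measure (t : R) (A : set T) : \bar R :=
  ereal_sup [set hausdorff_premeasure t delta A | delta in [set e | 0 < e]].

End HausdorffMeasure.

Section BetaExpansions.
Context {R : realType}.

(* 2^(- sup N) = inf_(n in N) 2^(-n) for N = {n | a, b agree on n digits};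
   0 always belongs to N, and N = nat with infimum 0 when a = b. *)
Definition seq_dist (a b : Sigma) : R :=
  inf [set 2 ^- n | n in [set n | forall i, (i < n)%N -> a i = b i]].

(* These values determine m, since cylinders form a generating pi-system. *)
Definition is_bernoulli (m : probability Sigma R) : Prop :=
  forall w : seq bool, m (cylinder w) = (2 ^- size w)%:E.

Variable beta : R.

Definition beta_interval : set R := `[0, (beta - 1)^-1].

Definition beta_proj (a : Sigma) : R :=
  limn (series (fun i => (a i)%:R * beta ^- i.+1)).

Definition beta_expansions (x : R) : set Sigma := beta_proj @^-1` [set x].

Definition bernoulli_convolution (m : probability Sigma R) : set R -> \bar R :=
  pushforward m beta_proj.

(* Only the values m_ x for x in beta_interval matter. *)
Definition is_disintegration (m : probability Sigma R)
    (m_ : R -> probability Sigma R) : Prop :=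
  [/\ forall A : set Sigma, measurable A ->
        measurable_fun beta_interval (fun x => m_ x A),
      \forall x \ae bernoulli_convolution m,
        beta_interval x -> m_ x (beta_expansions x) = 1%E
    & forall f : Sigma -> R, m.-integrable setT (EFin \o f) ->
        (\int[m]_a (f a)%:E =
         \int[bernoulli_convolution m]_(x in beta_interval)
           \int[m_ x]_(a in beta_expansions x) (f a)%:E)%E].

End BetaExpansions.

Definition ac_with_bounded_density {R : realType} (nu : set R -> \bar R) : Prop :=
  nu `<< (@lebesgue_measure R) /\
  exists g : R -> R,
    [/\ measurable_fun setT g, forall x, 0 <= g x,
        forall A : set R, measurable A ->
          (nu A = \int[lebesgue_measure]_(x in A) (g x)%:E)%E
      & (ess_sup (@lebesgue_measure R) (EFin \o g) < +oo)%E].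

(* Main.v *)
Require Import Defs.
From HB Require Import structures.
From mathcomp Require Import all_boot all_order all_algebra.
From mathcomp Require Import all_classical all_reals all_analysis measurable_realfun ess_sup_inf.
From mathcomp Require Import ring lra.

Set Implicit Arguments.
Unset Strict Implicit.
Unset Printing Implicit Defensive.

Import Order.TTheory GRing.Theory Num.Theory.
Import numFieldNormedType.Exports.

Local Open Scope classical_set_scope.
Local Open Scope ring_scope.

(** Write [T_i x = beta * x - i], let [E x] be the set of expansions of [x] and
    [c w = (beta / 2) ^+ size w], which is the diameter of the cylinder [w] to
    the power [t].  Since [a] lies in [E x] exactly when its shift lies in
    [E (T_i x)] for [i] the first digit of [a], cheap coverings of [E x] by
    finitely many words obey a recursion: the cost of covering with words of
    length at most [k] is [cover_cost k], where [cover_cost 0] is the indicator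
    of [I] and [cover_cost (k+1) = min(1_I, L (cover_cost k))], with
    [L u x = (beta / 2) * (u (T_0 x) + u (T_1 x))] ([transfer]).  The limit
    [g = limit_cost] satisfies [g <= L g].  But [L] preserves integrals against
    Lebesgue measure, so [g = L g] almost everywhere ([limit_cost_invariant]),
    and therefore [g = L^n g] for all [n].  As [L^n g] is the cost of covering
    with words of length at least [n], prescribing a small scale costs nothing
    more, and the Hausdorff measure of [E x] is at most [g x].  Conversely every
    countable covering of [E x] by cylinders costs at least [g x]
    ([limit_cost_le_cover]): otherwise, following an underpaid digit at each
    step, one reaches an expansion of [x] that is not covered.  Hence
    [H (E x) = g x] for almost every [x] ([hausdorff_expansions]), and [g <= 1].

    The measure [g dx] is invariant under the same self-similarity relation as
    the Bernoulli convolution [nu], and comparing the masses of half-lines at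
    smaller and smaller scales shows that this relation determines a measure up
    to a factor: [g dx = c nu], with [c] the integral of [g]
    ([limit_cost_density]).

    If [H (E x)] is positive almost everywhere then [c > 0] and [nu] has the
    density [g / c], bounded by [1 / c].  If [nu] is at most [C] times Lebesgue
    measure, then by induction on [k] it is at most [C * cover_cost k dx]
    ([nu_le_cover_cost]), so [C * c >= 1] and again [c > 0]; the set where [g]
    is positive is then of positive measure and contains small affine copies of
    itself around every point of [I], so by the Lebesgue density theorem it
    fills [I] ([ae_limit_cost_gt0]).

    Finally, with [nu = g / c dx] and [g <= 1], a disintegration satisfies
    [g x * m_x w <= c w] for all cylinders [w] and almost every [x]
    ([disintegration_bound]).  By the mass distribution principle
    [g x * m_x A <= H A] for Borel [A]; this inequality for [A] and for
    [E x \ A], whose right-hand sides add up to [H (E x) = g x], leaves only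
    equality ([measure_eq_hausdorff]). *)

(** * Hausdorff measure as an outer measure *)

Section HausdorffOuter.
Context {R : realType} {T : Type}.
Variable d : T -> T -> R.
Local Open Scope ereal_scope.

Lemma diam_ge0 (A : set T) : 0 <= diam d A.
Proof. by apply: ereal_sup_ubound; left. Qed.

Lemma le_diam (A : set T) (x : \bar R) : 0 <= x ->
  (forall a b, A a -> A b -> (d a b)%:E <= x) -> diam d A <= x.
Proof.
move=> x0 Ax; apply: ge_ereal_sup => _ [->//|[a Aa [b Ab <-]]].
exact: Ax.
Qed.

Lemma diam_set0 : diam d set0 = 0.
Proof. by apply/eqP; rewrite eq_le diam_ge0 le_diam. Qed.

Lemma diamS (A B : set T) : A `<=` B -> diam d A <= diam d B.
Proof.
move=> AB; apply: le_diam => [|a b Aa Ab]; first exact: diam_ge0.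
by apply: ereal_sup_ubound; right; exists a; [exact: AB|exists b => //; exact: AB].
Qed.

Variable t : R.
Hypothesis t0 : (0 < t)%R.

Lemma gauge_ge0 (A : set T) : 0 <= diam d A `^ t.
Proof. exact: poweR_ge0. Qed.

Lemma gauge_set0 : diam d set0 `^ t = 0.
Proof. by rewrite diam_set0 poweR0r// gt_eqF. Qed.

Lemma gaugeS (A B : set T) : A `<=` B -> diam d A `^ t <= diam d B `^ t.
Proof.
move=> AB; apply: gt0_ler_poweR; [exact: ltW| | |exact: diamS];
  by rewrite in_itv/= diam_ge0 leey.
Qed.

Lemma hausdorff_premeasure_ge0 delta A : 0 <= hausdorff_premeasure d t delta A.
Proof.
apply: le_ereal_inf_tmp => _ [U _ <-].
by apply: nneseries_ge0 => n _ _; exact: gauge_ge0.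
Qed.

Lemma hausdorff_premeasure_le delta A (U : nat -> set T) :
  A `<=` \bigcup_i U i -> (forall i, diam d (U i) <= delta%:E) ->
  hausdorff_premeasure d t delta A <= \sum_(i <oo) diam d (U i) `^ t.
Proof. by move=> AU Ud; apply: ereal_inf_lbound; exists U. Qed.

Lemma hausdorff_premeasure_ext delta (A B : set T) : A `<=` B ->
  hausdorff_premeasure d t delta A <= hausdorff_premeasure d t delta B.
Proof.
move=> AB; apply: le_ereal_inf_tmp => _ [U [BU Ud] <-].
by apply: hausdorff_premeasure_le => //; exact: subset_trans BU.
Qed.

Lemma hausdorff_premeasure_anti (e e' : R) A : (e <= e')%R ->
  hausdorff_premeasure d t e' A <= hausdorff_premeasure d t e A.
Proof.
move=> ee'; apply: le_ereal_inf_tmp => _ [U [XU Ud] <-].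
apply: hausdorff_premeasure_le => // i; apply: le_trans (Ud i) _.
by rewrite lee_fin.
Qed.

Lemma hausdorff_premeasure_set0 delta : (0 <= delta)%R ->
  hausdorff_premeasure d t delta set0 = 0.
Proof.
move=> d0; apply/eqP; rewrite eq_le hausdorff_premeasure_ge0 andbT.
apply: le_trans (@hausdorff_premeasure_le delta set0 (fun=> set0) _ _) _ => //.
  by move=> _; rewrite diam_set0 lee_fin.
by rewrite eseries0// => i _ _; exact: gauge_set0.
Qed.

Lemma hausdorff_premeasure_sigma_subadditive delta :
  sigma_subadditive (hausdorff_premeasure d t delta).
Proof.
move=> A; have [[i ioo]|] := pselect (exists i, hausdorff_premeasure d t delta (A i) = +oo).
  by rewrite (nneseries_pinfty _ _ ioo) ?leey// => n _; exact: hausdorff_premeasure_ge0.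
rewrite -forallNE => Aoo; apply/lee_addgt0Pr => e e0.
apply: le_trans (epsilon_trick _ _ (ltW e0)); last first.
  by move=> n; exact: hausdorff_premeasure_ge0.
pose P n (U : nat -> set T) := [/\ A n `<=` \bigcup_i U i,
  forall i, diam d (U i) <= delta%:E &
  \sum_(k <oo) diam d (U k) `^ t <=
  hausdorff_premeasure d t delta (A n) + (e / (2 ^ n.+1)%:R)%:E].
have [G PG] : {G : nat -> nat -> set T & forall n, P n (G n)}.
  apply: (@choice _ _ P) => n.
  have fin : hausdorff_premeasure d t delta (A n) \is a fin_num.
    rewrite ge0_fin_numE ?hausdorff_premeasure_ge0// ltey.
    by apply/eqP; exact: Aoo.
  have en : (0 < e / (2 ^ n.+1)%:R)%R by rewrite divr_gt0// ltr0n expn_gt0.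
  have [_ [U [AU Ud] <-] /ltW] := lb_ereal_inf_adherent en fin.
  by exists U.
have /card_esym/ppcard_eqP[f] := card_nat2.
pose V k := G (f k).1 (f k).2.
apply: (@le_trans _ _ (\sum_(k <oo) diam d (V k) `^ t)).
  apply: hausdorff_premeasure_le => [x [i _ Aix]|k]; last by have [_ + _] := PG (f k).1; exact.
  have [+ _ _] := PG i => /(_ _ Aix)[j _ Gij].
  by exists (f^-1%FUN (i, j)) => //; rewrite /V invK ?inE.
rewrite [leLHS]nneseries_esumT; last by move=> *; exact: gauge_ge0.
rewrite -(@reindex_esum R nat (nat * nat)%type setT setT f
   (fun p => diam d (G p.1 p.2) `^ t)) //.
have -> : [set: nat * nat] = [set: nat] `*`` (fun=> [set: nat]).
  by apply/seteqP; split.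
rewrite -(@esum_esum _ _ _ setT (fun=> setT) (fun i j => diam d (G i j) `^ t)); last first.
  by move=> *; exact: gauge_ge0.
rewrite -(eq_esum (fun i _ => nneseries_esumT (fun j => gauge_ge0 (G i j)))).
rewrite -nneseries_esumT; last first.
  by move=> i; apply: nneseries_ge0 => *; exact: gauge_ge0.
apply: lee_nneseries => [i _ _|i _]; last by have [] := PG i.
by apply: nneseries_ge0 => *; exact: gauge_ge0.
Qed.

Lemma hausdorff_premeasure_le_measure delta A : (0 < delta)%R ->
  hausdorff_premeasure d t delta A <= hausdorff_measure d t A.
Proof. by move=> d0; apply: ereal_sup_ubound; exists delta. Qed.

Lemma hausdorff_measure_ge0 A : 0 <= hausdorff_measure d t A.
Proof.
by apply: le_trans (hausdorff_premeasure_le_measure A ltr01);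
  exact: hausdorff_premeasure_ge0.
Qed.

Lemma hausdorff_measure_set0 : hausdorff_measure d t set0 = 0.
Proof.
apply/eqP; rewrite eq_le hausdorff_measure_ge0 andbT.
by apply: ge_ereal_sup => _ [e /= /ltW e0 <-]; rewrite hausdorff_premeasure_set0.
Qed.

Lemma le_hausdorff_measure :
  {homo hausdorff_measure d t : A B / A `<=` B >-> A <= B}.
Proof.
move=> A B AB; apply: ge_ereal_sup => _ [e /= e0 <-].
exact: le_trans (hausdorff_premeasure_ext e AB) (hausdorff_premeasure_le_measure _ e0).
Qed.

Lemma hausdorff_measure_sigma_subadditive :
  sigma_subadditive (hausdorff_measure d t).
Proof.
move=> A; apply: ge_ereal_sup => _ [e /= e0 <-].
apply: le_trans (hausdorff_premeasure_sigma_subadditive e A) _.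
apply: lee_nneseries => [i _ _|i _]; first exact: hausdorff_premeasure_ge0.
exact: hausdorff_premeasure_le_measure.
Qed.

HB.instance Definition _ := isOuterMeasure.Build R T (hausdorff_measure d t)
  hausdorff_measure_set0 hausdorff_measure_ge0 le_hausdorff_measure
  hausdorff_measure_sigma_subadditive.

Definition hausdorff_outer : {outer_measure set T -> \bar R} :=
  hausdorff_measure d t.

(** Once the covering sets are so small that none of them meets both [B] and its
    complement, a covering of [X] splits into coverings of the two parts of [X]
    at no extra cost. *)
Lemma hausdorff_caratheodory (B : set T) (delta0 : R) : (0 < delta0)%R ->
  (forall U, diam d U <= delta0%:E -> U `<=` B \/ U `<=` ~` B) ->
  caratheodory_measurable (hausdorff_measure d t) B.
Proof.
move=> d0 sep; apply: (@le_caratheodory_measurable _ _ hausdorff_outer) => X.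
rewrite /hausdorff_outer/=.
have split e : (0 < e)%R -> e%:E <= delta0%:E ->
    hausdorff_premeasure d t e (X `&` B) + hausdorff_premeasure d t e (X `&` ~` B)
    <= hausdorff_premeasure d t e X.
  move=> e0 ed; apply: le_ereal_inf_tmp => _ [U [XU Ud] <-].
  have sub (C : set T) : hausdorff_premeasure d t e (X `&` C) <=
      \sum_(i <oo) diam d (U i `&` C) `^ t.
    apply: hausdorff_premeasure_le => [x [/XU[i _ Uix] Cx]|i]; first by exists i.
    by apply: le_trans (Ud i); apply: diamS; exact: subIsetl.
  apply: le_trans (leeD (sub B) (sub (~` B))) _.
  rewrite -nneseriesD; [|by move=> *; exact: gauge_ge0..].
  apply: lee_nneseries => [i _ _|i _]; first by rewrite adde_ge0 ?gauge_ge0.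
  have [UB|UB] := sep (U i) (le_trans (Ud i) ed).
  - rewrite (_ : U i `&` ~` B = set0) ?gauge_set0 ?adde0; last first.
      by apply/seteqP; split => // x [/UB].
    by apply: gaugeS; exact: subIsetl.
  - rewrite (_ : U i `&` B = set0) ?gauge_set0 ?add0e; last first.
      by apply/seteqP; split => // x [/UB].
    by apply: gaugeS; exact: subIsetl.
have [Xoo|] := eqVneq (hausdorff_measure d t X) +oo; first by rewrite Xoo leey.
rewrite -ltey => Xoo.
have fin C : hausdorff_measure d t (X `&` C) \is a fin_num.
  rewrite ge0_fin_numE ?hausdorff_measure_ge0//; apply: le_lt_trans Xoo.
  by apply: le_hausdorff_measure; exact: subIsetl.
rewrite -leeBrDr//; apply: ge_ereal_sup => _ [e /= e0 <-].
rewrite leeBrDr// -leeBrDl; last first.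
  rewrite ge0_fin_numE ?hausdorff_premeasure_ge0//; apply: le_lt_trans Xoo.
  apply: le_trans (hausdorff_premeasure_le_measure _ e0) _.
  by apply: le_hausdorff_measure; exact: subIsetl.
apply: ge_ereal_sup => _ [e' /= e'0 <-].
rewrite leeBrDl; last first.
  rewrite ge0_fin_numE ?hausdorff_premeasure_ge0//; apply: le_lt_trans Xoo.
  apply: le_trans (hausdorff_premeasure_le_measure _ e0) _.
  by apply: le_hausdorff_measure; exact: subIsetl.
pose r := Num.min (Num.min e e') delta0.
have re : (r <= e)%R by rewrite !ge_min lexx.
have re' : (r <= e')%R by rewrite !ge_min lexx orbT.
have r0 : (0 < r)%R by rewrite !lt_min e0 e'0 d0.
apply: le_trans (leeD (hausdorff_premeasure_anti _ re) (hausdorff_premeasure_anti _ re')) _.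
apply: le_trans (split r r0 _) _; first by rewrite lee_fin ge_min lexx orbT.
exact: hausdorff_premeasure_le_measure.
Qed.

End HausdorffOuter.

(** * Cylinders and coverings by cylinders *)

(** The two defects [c - s * a] and [d - s * b] are nonnegative and add up to [0]. *)
Lemma eq_of_le_sum {R : realType} (s : R) (a b c d : \bar R) : (0 <= s)%R ->
  (a + b = 1 -> c + d = s%:E -> 0 <= a -> 0 <= b -> 0 <= c -> 0 <= d ->
  s%:E * a <= c -> s%:E * b <= d -> s%:E * a = c)%E.
Proof.
move: a b c d => [a| |] [b| |] [c| |] [d| |] //= s0.
rewrite -!EFinD -!EFinM !lee_fin => -[ab] [cd] a0 b0 c0 d0 sa sb.
by congr (_%:E); nra.
Qed.

Section Cylinders.
Context {R : realType}.
Implicit Types (a b : Sigma) (w : seq bool) (A U : set Sigma).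

Lemma cylinder_nil : cylinder [::] = setT.
Proof. by apply/seteqP; split. Qed.

Lemma cylinder_mkseqP a b n :
  cylinder (mkseq a n) b <-> forall i, (i < n)%N -> b i = a i.
Proof.
split=> [ab i ilt|ab i]; last by rewrite size_mkseq => ilt; rewrite nth_mkseq// ab.
by rewrite ab ?size_mkseq// nth_mkseq.
Qed.

Lemma cylinder_cons x w a :
  cylinder (x :: w) a <-> a 0%N = x /\ cylinder w (fun i => a i.+1).
Proof.
split=> [xwa|[ax wa] [|i]//=]; last exact: wa.
by split=> [|i ilt]; [exact: (xwa 0%N)|exact: (xwa i.+1)].
Qed.

Lemma seq_dist_le a b n : (forall i, (i < n)%N -> a i = b i) ->
  seq_dist a b <= 2 ^- n :> R.
Proof.
move=> ab; apply: ge_inf; last by exists n.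
by exists 0 => _ [k _ <-]; rewrite invr_ge0 exprn_ge0.
Qed.

(** Combined with [seq_dist_le] at the first index of disagreement, this computes
    the distance. *)
Lemma seq_dist_ge a b n : a n != b n -> 2 ^- n <= seq_dist a b :> R.
Proof.
move=> ab; apply: lb_le_inf => [|_ [k kab <-]]; first by exists (2 ^- 0); exists 0%N.
rewrite lef_pV2 ?posrE ?exprn_gt0// ler_eXn2l ?ltr1n//.
by rewrite leqNgt; apply: contra ab => /kab ->.
Qed.

Lemma diam_cylinder w : (diam seq_dist (cylinder w) <= (2 ^- size w : R)%:E)%E.
Proof.
apply: le_diam => [|a b wa wb]; first by rewrite lee_fin invr_ge0 exprn_ge0.
by rewrite lee_fin; apply: seq_dist_le => i ilt; rewrite wa// wb.
Qed.

Lemma small_diam_cylinder w U : (diam seq_dist U <= (2 ^- size w : R)%:E)%E ->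
  U `<=` cylinder w \/ U `<=` ~` cylinder w.
Proof.
move=> Uw; have [[a [Ua wa]]|no] := pselect (exists a, U a /\ cylinder w a).
  left=> b Ub i ilt; apply/eqP/negPn/negP => bi.
  have : (2 ^- i <= (2 : R) ^- size w).
    rewrite -lee_fin; apply: le_trans Uw.
    apply: (@le_trans _ _ (seq_dist b a)%:E).
      by rewrite lee_fin; apply: seq_dist_ge; rewrite wa.
    by apply: ereal_sup_ubound; right; exists b => //; exists a.
  by rewrite lef_pV2 ?posrE ?exprn_gt0// ler_eXn2l ?ltr1n// leqNgt ilt.
by right=> a Ua wa; apply: no; exists a.
Qed.

Lemma measurable_cylinder w : measurable (cylinder w : set Sigma).
Proof. by apply: sub_sigma_algebra; exists w. Qed.

Variable beta : R.
Hypothesis hbeta : 1 < beta < 2.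

Let t : R := ln (2 / beta) / ln 2.

Let beta_gt0 : 0 < beta. Proof. by case/andP: hbeta => /(lt_trans ltr01). Qed.

Lemma dimension_gt0 : 0 < t.
Proof.
case/andP: hbeta => b1 b2; rewrite /t divr_gt0// ln_gt0 ?ltr1n//.
by rewrite ltr_pdivlMr// mul1r.
Qed.

(** This is where the value of the dimension enters: a cylinder of length [n] has
    gauge [(beta / 2) ^+ n]. *)
Lemma powR_dimension n : (2 ^- n) `^ t = (beta / 2) ^+ n :> R.
Proof.
have l2 : ln 2 != 0 :> R by rewrite gt_eqF// ln_gt0 ?ltr1n.
rewrite /powR gt_eqF ?invr_gt0 ?exprn_gt0// lnV ?posrE ?exprn_gt0//.
rewrite lnXn// (_ : t * _ = (- ln (2 / beta)) *+ n); last first.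
  by rewrite /t mulrN mulrnAr divfK// mulNrn.
by rewrite -lnV ?posrE ?divr_gt0// invf_div -[_ *+ n]mulr_natr expRM_natr lnK ?posrE ?divr_gt0.
Qed.

Lemma ratio_itv : 0 < beta / 2 < 1.
Proof.
case/andP: hbeta => b1 b2.
by rewrite divr_gt0//= ltr_pdivrMr// mul1r.
Qed.

Let H := hausdorff_measure (@seq_dist R) t.

(** Coverings are sequences of optional words, so that [None] can pad finite
    coverings and replace empty covering sets. *)
Definition cyl_of (o : option (seq bool)) : set Sigma :=
  if o is Some w then cylinder w else set0.

Definition cost (o : option (seq bool)) : R :=
  if o is Some w then (beta / 2) ^+ size w else 0.

Lemma cost_ge0 o : 0 <= cost o.
Proof. by case: o => //= w; rewrite exprn_ge0// ltW//; case/andP: ratio_itv. Qed.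

Lemma gauge_cylinder o : (diam seq_dist (cyl_of o) `^ t <= (cost o)%:E)%E.
Proof.
case: o => [w|] /=; last by rewrite gauge_set0 ?dimension_gt0.
rewrite -powR_dimension -poweR_EFin; apply: gt0_ler_poweR.
- exact/ltW/dimension_gt0.
- by rewrite in_itv/= diam_ge0 leey.
- by rewrite in_itv/= lee_fin invr_ge0 exprn_ge0// leey.
- exact: diam_cylinder.
Qed.

(** A nonempty set lies in the cylinder of the digits common to all its elements,
    which has the same diameter.  The tolerance [e] is for sets with one element,
    for which a long enough cylinder is taken. *)
Lemma cover_by_cylinder U (e : R) : 0 < e -> exists2 o, U `<=` cyl_of o &
  ((cost o)%:E <= diam seq_dist U `^ t + e%:E)%E.
Proof.
move=> e0; have [[a Ua]|] := pselect (exists a, U a); last first.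
  rewrite -forallNE => U0; exists None => [a /U0//|/=].
  by rewrite adde_ge0 ?gauge_ge0// lee_fin ltW.
have [q0 q1] := andP ratio_itv.
have [Ua_all|] := pselect (forall n, U `<=` cylinder (mkseq a n)).
  have : (beta / 2) ^+ n @[n --> \oo] --> (0 : R).
    by apply: cvg_expr; rewrite gtr0_norm.
  move=> /cvgrPdist_lt/(_ _ e0)[n _ /(_ n (leqnn n))] /=.
  rewrite sub0r normrN ger0_norm ?exprn_ge0 1?ltW// => qn.
  exists (Some (mkseq a n)) => /=; first exact: Ua_all.
  by rewrite size_mkseq -[leLHS]add0e leeD ?gauge_ge0// lee_fin ltW.
move=> /existsNP/cid[n0 n0P].
have ex : exists n, ~~ `[< U `<=` cylinder (mkseq a n) >].
  by exists n0; apply/asboolPn.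
have [n /asboolPn nP nmin] := ex_minnP ex.
case: n nP nmin => [[]|n nP nmin]; first by rewrite cylinder_nil.
have Uan : U `<=` cylinder (mkseq a n).
  by apply/asboolP/negPn/negP => /nmin; rewrite ltnn.
exists (Some (mkseq a n)) => //=.
move/existsNP : nP => [b /not_implyP[Ub /cylinder_mkseqP/existsNP[i /not_implyP[]]]].
rewrite ltnS leq_eqVlt => /predU1P[-> /eqP ban|ilt]; last first.
  by move/cylinder_mkseqP : (Uan _ Ub) => /(_ _ ilt).
rewrite size_mkseq -powR_dimension -poweR_EFin -[leLHS]adde0 leeD//; last first.
  by rewrite lee_fin ltW.
apply: gt0_ler_poweR.
- exact/ltW/dimension_gt0.
- by rewrite in_itv/= lee_fin invr_ge0 exprn_ge0// leey.
- by rewrite in_itv/= diam_ge0 leey.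
- apply: (@le_trans _ _ (seq_dist b a)%:E); first by rewrite lee_fin seq_dist_ge.
  by apply: ereal_sup_ubound; right; exists b => //; exists a.
Qed.

Lemma le_hausdorff_cyl A (x : \bar R) :
  (forall W : nat -> option (seq bool), A `<=` \bigcup_i cyl_of (W i) ->
    (x <= \sum_(i <oo) (cost (W i))%:E)%E) ->
  (x <= H A)%E.
Proof.
move=> xW; apply: le_trans (hausdorff_premeasure_le_measure seq_dist t A ltr01).
apply: le_ereal_inf_tmp => _ [U [AU _] <-]; apply/lee_addgt0Pr => e e0.
apply: le_trans (epsilon_trick _ _ (ltW e0)); last by move=> n; exact: gauge_ge0.
have en n : 0 < e / (2 ^ n.+1)%:R by rewrite divr_gt0// ltr0n expn_gt0.
pose P n o := U n `<=` cyl_of o /\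
  ((cost o)%:E <= diam seq_dist (U n) `^ t + (e / (2 ^ n.+1)%:R)%:E)%E.
have [W WP] : {W & forall n, P n (W n)}.
  apply: choice => n; have [w Uw wU] := cover_by_cylinder (U n) (en n).
  by exists w.
apply: (@le_trans _ _ (\sum_(i <oo) (cost (W i))%:E)%E).
  by apply: xW => a /AU[n _ Una]; exists n => //; exact: (WP n).1.
apply: lee_nneseries => [i _ _|i _]; last exact: (WP i).2.
by rewrite lee_fin cost_ge0.
Qed.

Lemma premeasure_le_list A (L : seq (seq bool)) n :
  all (fun w => n <= size w)%N L -> A `<=` [set a | exists2 w, w \in L & cylinder w a] ->
  (hausdorff_premeasure seq_dist t (2 ^- n) A <=
   (\sum_(w <- L) (beta / 2) ^+ size w)%:E)%E.
Proof.
move=> /allP Ln AL.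
pose W i := nth None (map some L) i.
have Wbig i : (size L <= i)%N -> W i = None.
  by move=> Li; rewrite /W nth_default// size_map.
apply: le_trans (@hausdorff_premeasure_le _ _ _ _ _ A (fun i => cyl_of (W i)) _ _) _.
- move=> a /AL[w wL wa]; exists (index w L) => //.
  by rewrite /W (nth_map [::]) ?index_mem// nth_index.
- move=> i; have [iL|/Wbig ->] := ltnP i (size L); last first.
    by rewrite /= diam_set0 lee_fin invr_ge0 exprn_ge0.
  rewrite /W (nth_map [::])//=; apply: le_trans (diam_cylinder _) _.
  rewrite lee_fin lef_pV2 ?posrE ?exprn_gt0// ler_eXn2l ?ltr1n// Ln//.
  exact: mem_nth.
- apply: (@le_trans _ _ (\sum_(i <oo) (cost (W i))%:E)%E).
    by apply: lee_nneseries => [i _ _|i _]; [exact: gauge_ge0|exact: gauge_cylinder].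
  rewrite (nneseries_split _ (size L)); last by move=> *; rewrite lee_fin cost_ge0.
  rewrite add0n [X in (_ + X)%E]eseries0 ?adde0; last first.
    by move=> i Li _; rewrite Wbig.
  rewrite (big_nth [::]) -sumEFin le_eqVlt; apply/orP; left; apply/eqP.
  apply: eq_big_nat => i /andP[_ iL].
  by rewrite /W (nth_map [::]).
Qed.

(** A cylinder and its complement are at positive distance. *)
Lemma measurable_caratheodory A : measurable A -> caratheodory_measurable H A.
Proof.
have t0 := dimension_gt0.
suff : <<s range cylinder >> `<=` H.-caratheodory by exact.
apply: smallest_sub => [|_ [w _ <-]]; last first.
  apply: (hausdorff_caratheodory t0 _ (@small_diam_cylinder w)).
  by rewrite invr_gt0 exprn_gt0.
split=> [|B|F].
- exact: (caratheodory_measurable_set0 (hausdorff_outer seq_dist t0)).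
- rewrite setTD; exact: (caratheodory_measurable_setC (mu := hausdorff_outer seq_dist t0)).
- exact: (caratheodory_measurable_bigcup (mu := hausdorff_outer seq_dist t0)).
Qed.

(** Mass distribution principle: the bound on cylinders passes through coverings
    to [s * mu A <= H A].  Applied to [A] and to its complement in [E], with equal
    total masses, it forces equality. *)
Lemma measure_eq_hausdorff (mu : {measure set Sigma -> \bar R}) (s : R) (E : set Sigma) :
  (0 <= s) ->
  (forall w, s%:E * mu (cylinder w) <= ((beta / 2) ^+ size w)%:E)%E ->
  measurable E -> mu E = 1%E -> H E = s%:E ->
  forall A, measurable A -> A `<=` E -> (s%:E * mu A = H A)%E.
Proof.
move=> s0 smu mE muE HE.
have le_mu A : measurable A -> (s%:E * mu A <= H A)%E.
  move=> mA; apply: le_hausdorff_cyl => W AW.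
  have mW i : measurable (cyl_of (W i)).
    by case: (W i) => [w|] /=; [exact: measurable_cylinder|exact: measurable0].
  apply: (@le_trans _ _ (s%:E * \sum_(i <oo) mu (cyl_of (W i)))%E).
    rewrite lee_wpmul2l// ?lee_fin//.
    exact: measure_sigma_subadditive.
  rewrite -nneseriesZl//; apply: lee_nneseries => [i _ _|i _].
    by rewrite mule_ge0.
  by case: (W i) => [w|] /=; rewrite ?measure0 ?mule0.
move=> A mA AE.
have HAE : (H A + H (E `\` A) = s%:E)%E.
  by rewrite -HE [RHS](measurable_caratheodory mA) setIC setIidl// setDE.
have muAE : (mu A + mu (E `\` A) = 1)%E.
  rewrite -muE -measureU//; [|exact: measurableD|by rewrite setDE setICA setICr setI0].
  by congr (mu _); apply/seteqP; split => a; rewrite /setU/setD/=;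
    have [|] := pselect (A a); try tauto; move/AE; tauto.
apply: (@eq_of_le_sum _ _ _ (mu (E `\` A)) _ (H (E `\` A))) => //;
  do ?[exact: measure_ge0 | exact: hausdorff_measure_ge0].
- exact: le_mu.
- by apply: le_mu; exact: measurableD.
Qed.

End Cylinders.

(** * The coding map and the Bernoulli measure *)

Definition seq_shift (a : Sigma) : Sigma := fun i => a i.+1.

Definition digit (R : realType) (a : Sigma) : R := (a 0%N)%:R.

Lemma measurable_head (x : bool) : measurable [set a : Sigma | a 0%N = x].
Proof.
rewrite (_ : [set a | _] = cylinder [:: x]); first exact: measurable_cylinder.
by apply/seteqP; split=> [a ax [|]//|a /(_ 0%N)]; apply.
Qed.

Lemma measurable_shift : measurable_fun setT seq_shift.
Proof.
apply: (@measurability _ _ Sigma Sigma setT seq_shift (range cylinder)) => // _ [_ [w _ <-] <-].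
rewrite setTI (_ : _ @^-1` _ = cylinder (false :: w) `|` cylinder (true :: w)).
  by apply: measurableU; exact: measurable_cylinder.
apply/seteqP; split=> [a wa|a [] /cylinder_cons[]//].
by case E : (a 0%N); [right|left]; apply/cylinder_cons.
Qed.

Lemma measurable_preimage_shift (A : set Sigma) :
  measurable A -> measurable (seq_shift @^-1` A).
Proof. by move=> mA; rewrite -[_ @^-1` _]setTI; exact: measurable_shift. Qed.

Lemma cylinder_consE x w :
  cylinder (x :: w) = [set a : Sigma | a 0%N = x] `&` seq_shift @^-1` cylinder w.
Proof. by apply/seteqP; split => a /cylinder_cons. Qed.

Section Bernoulli.
Context {R : realType} (m : probability Sigma R).
Hypothesis hm : is_bernoulli m.

(** The empty set is added because disjoint cylinders exist. *)
Lemma setI_closed_cylinders : setI_closed (range cylinder `|` [set set0]).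
Proof.
have pref v w : (size v <= size w)%N ->
    (range cylinder `|` [set set0]) (cylinder v `&` cylinder w).
  move=> vw; have [[a [va wa]]|no] := pselect (exists a, cylinder v a /\ cylinder w a).
    left; exists w => //; apply/seteqP; split=> [b wb|b []//]; split => // i iv.
    by rewrite wb ?(leq_trans iv)// -wa ?(leq_trans iv)// va.
  by right; apply/seteqP; split => // a [va wa]; apply: no; exists a.
move=> _ _ [[v _ <-]|->] [[w _ <-]|->]; rewrite ?set0I ?setI0; try by right.
have [|/ltnW] := leqP (size v) (size w); first exact: pref.
by rewrite setIC; exact: pref.
Qed.

Lemma measurable_cylindersE :
  @measurable _ Sigma = <<s range cylinder `|` [set set0] >>.
Proof.
apply/seteqP; split; first exact: sub_sigma_algebra2.
apply: smallest_sub; first exact: sigma_algebra_measurable.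
by move=> _ [[w _ <-]|->]; [exact: measurable_cylinder|exact: measurable0].
Qed.

Lemma bernoulli_shift x (A : set Sigma) : measurable A ->
  m ([set a | a 0%N = x] `&` seq_shift @^-1` A) = (2^-1%:E * m A)%E.
Proof.
move=> mA.
have half_ge0 : 0 <= 2^-1 :> R by rewrite invr_ge0.
pose half : {nonneg R} := NngNum half_ge0.
have mm1 : {mu : {measure set Sigma -> \bar R} |
    forall B, mu B = m (seq_shift @^-1` B `&` [set a | a 0%N = x])}.
  have mf := measurable_shift.
  unshelve eexists.
    refine (pushforward (mrestr m (measurable_head x)) seq_shift : {measure set Sigma -> \bar R}).
    exact: mf.
  by [].
have [mu muE] := mm1.
rewrite setIC -muE -[RHS]/(mscale half m A).
apply: (measure_unique _ (fun=> setT) measurable_cylindersE setI_closed_cylinders) => //.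
- by move=> _; left; exists [::] => //; exact: cylinder_nil.
- by apply/seteqP; split => // a _; exists 0%N.
- move=> _ [[w _ <-]|->]; last by rewrite !measure0.
  transitivity ((2^-1)%:E * m (cylinder w))%E => //.
  by rewrite muE setIC -cylinder_consE !hm -EFinM -invfM -exprS.
- move=> _; rewrite muE; apply: le_lt_trans (ltry 1); apply: probability_le1.
  apply: measurableI; last exact: measurable_head.
  exact: measurable_preimage_shift.
Qed.

End Bernoulli.

Section Coding.
Context {R : realType}.
Variable beta : R.
Hypothesis hbeta : 1 < beta < 2.

Let beta_gt1 : 1 < beta. Proof. by case/andP: hbeta. Qed.
Let beta_gt0 : 0 < beta. Proof. exact: lt_trans beta_gt1. Qed.
Let beta_neq0 : beta != 0. Proof. by rewrite gt_eqF. Qed.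

Notation proj := (beta_proj beta).
Notation len := ((beta - 1)^-1).

Lemma len_gt0 : 0 < len.
Proof. by rewrite invr_gt0 subr_gt0. Qed.

Let cvg_geom : series (geometric beta^-1 beta^-1) @ \oo --> len.
Proof.
have -> : len = beta^-1 * (1 - beta^-1)^-1.
  by rewrite -invfM mulrBr mulr1 divff.
by apply: cvg_geometric_series; rewrite gtr0_norm ?invr_gt0// invf_lt1.
Qed.

Let term_le (a : Sigma) i : 0 <= (a i)%:R * beta ^- i.+1 <= geometric beta^-1 beta^-1 i.
Proof.
rewrite /geometric/= -exprVn -exprS; case: (a i); rewrite ?mul1r ?mul0r ?lexx ?andbT/=;
  by rewrite exprn_ge0// invr_ge0 ltW.
Qed.

Let cvg_proj (a : Sigma) : cvgn (series (fun i => (a i)%:R * beta ^- i.+1 : R)).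
Proof.
apply: (@series_le_cvg _ _ (geometric beta^-1 beta^-1)).
- by move=> n; case/andP: (term_le a n).
- by move=> n; case/andP: (term_le a n); exact: le_trans.
- by move=> n; case/andP: (term_le a n).
- by apply/cvg_ex; exists len; exact: cvg_geom.
Qed.

Lemma beta_proj_itv a : 0 <= proj a <= len.
Proof.
apply/andP; split.
  apply: limr_ge; first exact: cvg_proj.
  by apply: nearW => n; apply: sumr_ge0 => i _; case/andP: (term_le a i).
rewrite -(cvg_lim _ cvg_geom)//; apply: ler_lim; first exact: cvg_proj.
  by apply/cvg_ex; exists len; exact: cvg_geom.
by apply: nearW => n; apply: ler_sum => i _; case/andP: (term_le a i).
Qed.

Lemma beta_proj_shift a : proj (seq_shift a) = beta * proj a - digit R a.
Proof.
apply/cvg_lim => //.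
have -> : series (fun i => (seq_shift a i)%:R * beta ^- i.+1) =
   (fun n => beta * series (fun i => (a i)%:R * beta ^- i.+1) n.+1 - digit R a).
  apply/funext => n; rewrite /series/= big_nat_recl//= mulrDr expr1.
  rewrite mulrCA divff// mulr1 addrAC subrr add0r mulr_sumr.
  by apply: eq_bigr => i _; rewrite mulrCA [in RHS]exprS invfM mulVKf.
apply: cvgB; last exact: cvg_cst.
apply: cvgM; first exact: cvg_cst.
by rewrite (cvg_shiftS (series _)); exact: cvg_proj.
Qed.

(** Any bounded orbit of the expanding maps driven by the digits of [a] starts at
    the projection of [a]: the distance between two such orbits grows like
    [beta ^+ n]. *)
Lemma beta_proj_unique (a : Sigma) (y : nat -> R) :
  (forall n, 0 <= y n <= len) -> (forall n, y n.+1 = beta * y n - (a n)%:R) ->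
  proj a = y 0%N.
Proof.
move=> yI yS; pose s n : Sigma := iter n seq_shift a.
have sE n : s n 0%N = a n.
  suff : forall k, s n k = a (n + k)%N by move=> ->; rewrite addn0.
  elim: n => // n IH k; rewrite /s iterS/= {1}/seq_shift -/(s n) IH.
  by rewrite addSnnS.
have dist n : `|proj (s n) - y n| = beta ^+ n * `|proj a - y 0%N|.
  elim: n => [|n IH]; first by rewrite mul1r.
  rewrite /s iterS -/(s n) beta_proj_shift yS /digit sE.
  rewrite (_ : _ - _ = beta * (proj (s n) - y n)); last by ring.
  by rewrite normrM IH mulrA (gtr0_norm beta_gt0) -exprS.
apply/eqP; rewrite -subr_eq0 -normr_eq0; apply/negPn/negP => ne0.
have pos : 0 < `|proj a - y 0%N| by rewrite lt_def ne0 normr_ge0.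
have : beta^-1 ^+ n @[n --> \oo] --> (0 : R).
  by apply: cvg_expr; rewrite gtr0_norm ?invr_gt0// invf_lt1.
have e0 : 0 < `|proj a - y 0%N| / len by rewrite divr_gt0// len_gt0.
move=> /cvgrPdist_lt/(_ _ e0)[n _ /(_ n (leqnn n))] /=.
rewrite sub0r normrN ger0_norm ?exprn_ge0 ?invr_ge0 1?ltW//.
rewrite exprVn ltr_pdivlMr ?len_gt0// mulrC ltr_pdivrMr ?exprn_gt0// mulrC -dist.
rewrite ltNge => /negP; apply.
have := yI n; have := beta_proj_itv (s n).
by rewrite ler_norml => /andP[? ?] /andP[? ?]; apply/andP; split; lra.
Qed.

Lemma measurable_beta_proj : measurable_fun setT proj.
Proof.
pose f n (a : Sigma) : R := series (fun i => (a i)%:R * beta ^- i.+1) n.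
apply: (@measurable_fun_cvg _ _ _ _ f) => [n|a _]; last exact: cvg_proj.
rewrite /f /series/=; apply: measurable_sum => i.
apply: measurable_funM => //.
rewrite (_ : (fun a : Sigma => _) = \1_[set a | a i = true]); last first.
  by apply/funext => a; rewrite indicE; case: (boolP (a i)) => ai;
    [rewrite mem_set|rewrite memNset//; exact/negP].
apply: measurable_indic.
elim: i => [|i IH]; first exact: measurable_head.
exact: (measurable_preimage_shift IH).
Qed.

Lemma measurable_preimage_proj (B : set R) :
  measurable B -> measurable (proj @^-1` B : set Sigma).
Proof. by move=> mB; rewrite -[_ @^-1` _]setTI; exact: measurable_beta_proj. Qed.

Lemma measurable_beta_expansions x : measurable (beta_expansions beta x).
Proof. exact: measurable_preimage_proj. Qed.

(** Reading the first digit [i] of an expansion, and prepending it. *)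
Definition expand (i : bool) (x : R) : R := beta * x - i%:R.
Definition contract (i : bool) (x : R) : R := (x + i%:R) / beta.

Lemma expandE i x : expand i x = beta * x - i%:R.
Proof. by []. Qed.

Lemma contractE i x : contract i x = (x + i%:R) / beta.
Proof. by []. Qed.

Lemma expandK i : cancel (expand i) (contract i).
Proof. by move=> x; rewrite /expand /contract subrK mulrC mulKf. Qed.

Lemma contractK i : cancel (contract i) (expand i).
Proof. by move=> x; rewrite /expand /contract mulrC divfK// addrK. Qed.

Lemma measurable_expand i : measurable_fun setT (expand i).
Proof. by apply: measurable_funB => //; exact: measurable_funM. Qed.

Lemma measurable_contract i : measurable_fun setT (contract i).
Proof. by apply: measurable_funM => //; exact: measurable_funD. Qed.

Lemma measurable_contract_preimage i (B : set R) :
  measurable B -> measurable (contract i @^-1` B).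
Proof. by move=> mB; rewrite -[_ @^-1` _]setTI; exact: measurable_contract. Qed.

Lemma beta_expansionsS x a :
  beta_expansions beta x a <-> beta_expansions beta (expand (a 0%N) x) (seq_shift a).
Proof.
rewrite /beta_expansions/= beta_proj_shift /expand /digit; split=> [->//|/addIr].
exact: mulfI.
Qed.

Lemma beta_expansions_out x : ~ beta_interval beta x -> beta_expansions beta x = set0.
Proof.
move=> xI; apply/seteqP; split => // a ax; apply: xI.
by rewrite /beta_interval/= in_itv/= -ax beta_proj_itv.
Qed.

Definition proj_measure (m : probability Sigma R) : {measure set R -> \bar R}.
Proof.
refine (pushforward m proj : {measure set R -> \bar R}).
exact: measurable_beta_proj.
Defined.

Lemma beta_proj_contract (m : probability Sigma R) (hm : is_bernoulli m)
    i (w : seq bool) (B : set R) : measurable B ->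
  (m (cylinder (i :: w) `&` proj @^-1` B) =
   2^-1%:E * m (cylinder w `&` proj @^-1` (contract i @^-1` B)))%E.
Proof.
move=> mB; rewrite cylinder_consE -setIA.
rewrite -(bernoulli_shift hm i); last first.
  apply: measurableI; first exact: measurable_cylinder.
  apply: measurable_preimage_proj; exact: measurable_contract_preimage.
congr (m _); apply/seteqP; split => a [ai [wa Ba]]; split => //; split => //=.
- by rewrite beta_proj_shift /digit ai -/(expand i _) expandK.
- by move: Ba; rewrite /= beta_proj_shift /digit ai -/(expand i _) expandK.
Qed.

End Coding.

(** * The transfer operator and the cost of covering *)

Section Transfer.
Context {R : realType}.
Variable beta : R.
Hypothesis hbeta : 1 < beta < 2.

Let beta_gt1 : 1 < beta. Proof. by case/andP: hbeta. Qed.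
Let beta_gt0 : 0 < beta. Proof. exact: lt_trans beta_gt1. Qed.
Let beta_neq0 : beta != 0. Proof. by rewrite gt_eqF. Qed.

Local Notation leb := (@lebesgue_measure R).
Local Notation expand := (expand beta).
Local Notation contract := (contract beta).
Local Notation I := (beta_interval beta).
Local Notation len := ((beta - 1)^-1).

Lemma measurable_I : measurable I.
Proof. exact: measurable_itv. Qed.

Lemma lebesgue_I : leb I = len%:E.
Proof.
by rewrite lebesgue_measure_itv/= lte_fin invr_gt0 subr_gt0 beta_gt1 -EFinB subr0.
Qed.

Lemma lebesgue_contract i (B : set R) : measurable B ->
  leb (contract i @^-1` B) = (beta%:E * leb B)%E.
Proof.
move=> mB.
have binv_ge0 : 0 <= beta^-1 by rewrite invr_ge0 ltW.
pose k : {nonneg R} := NngNum binv_ge0.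
have [mu muE] : {mu : {measure set (measurableTypeR R) -> \bar R} |
    forall B, mu B = leb (contract i @^-1` B)}.
  unshelve eexists.
    refine (pushforward leb (contract i : _ -> measurableTypeR R)
              : {measure set (measurableTypeR R) -> \bar R}).
    exact: measurable_contract.
  by [].
pose mu' : {measure set (measurableTypeR R) -> \bar R} := mscale k mu.
have scaleE C : mu' C = (beta^-1%:E * leb (contract i @^-1` C))%E.
  by rewrite -muE.
have -> : leb B = mu' B.
  apply: lebesgue_measure_unique => // _ [[a b] _ <-]; rewrite scaleE/=.
  have -> : contract i @^-1` `]a, b]%classic = `]expand i a, expand i b]%classic.
    apply/seteqP; split => x /=; rewrite !in_itv/= /contract /expand;
      by rewrite ltr_pdivlMr// ler_pdivrMr// ltrBlDr lerBrDr ![beta * _]mulrC.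
  rewrite !lebesgue_measure_itv/= !lte_fin /expand ltrD2r ltr_pM2l//.
  case: ifP => _; last by rewrite mule0.
  by rewrite -!EFinB -EFinM; congr EFin; field.
by rewrite scaleE muleA -EFinM divff// mul1e.
Qed.

Lemma integral_expand i (u : R -> R) (B : set R) :
  measurable B -> measurable_fun setT u -> (forall x, 0 <= u x) ->
  (\int[leb]_(x in B) (u (expand i x))%:E =
   beta^-1%:E * \int[leb]_(x in contract i @^-1` B) (u x)%:E)%E.
Proof.
move=> mB mu u0.
have mue : measurable_fun setT (u \o expand i).
  by apply: measurableT_comp => //; exact: measurable_expand.
have b0 : 0 <= beta by exact: ltW.
pose k : {nonneg R} := NngNum b0.
have -> : (\int[leb]_(x in contract i @^-1` B) (u x)%:E =
   \int[pushforward leb (contract i : _ -> measurableTypeR R)]_(x in B) (u (expand i x))%:E)%E.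
  rewrite ge0_integral_pushforward//=.
  - by apply: eq_integral => x _; rewrite contractK.
  - exact: measurable_contract.
  - by apply/measurable_EFinP; exact: measurable_funTS.
  - by move=> y _; rewrite lee_fin.
have -> : (\int[pushforward leb (contract i : _ -> measurableTypeR R)]_(x in B)
     (u (expand i x))%:E = \int[mscale k leb]_(x in B) (u (expand i x))%:E)%E.
  have mc := measurable_contract.
  apply: (@eq_measure_integral _ (measurableTypeR R)) => [|mc' A mA _].
    exact: mc.
  exact: (lebesgue_contract i mA).
rewrite ge0_integral_mscale//=.
- by rewrite muleA -EFinM mulVf// mul1e.
- by apply/measurable_EFinP; exact: measurable_funTS.
- by move=> y _; rewrite lee_fin.
Qed.

(** The coefficient is the gauge of a cylinder of length one, so this relates a
    covering cost at [x] to those at the two points reached by reading a digit; it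
    is also the transfer operator of the two contractions with equal weights
    relative to Lebesgue measure. *)
Definition transfer (u : R -> R) (x : R) : R :=
  beta / 2 * (u (expand false x) + u (expand true x)).

Lemma transferE u x :
  transfer u x = beta / 2 * (u (expand false x) + u (expand true x)).
Proof. by []. Qed.

Lemma transfer_ge0 u : (forall x, 0 <= u x) -> forall x, 0 <= transfer u x.
Proof. by move=> u0 x; rewrite mulr_ge0 ?addr_ge0// divr_ge0// ltW. Qed.

Lemma le_transfer u v : (forall x, u x <= v x) -> forall x, transfer u x <= transfer v x.
Proof. by move=> uv x; rewrite ler_wpM2l ?lerD// divr_ge0// ltW. Qed.

Lemma measurable_transfer u : measurable_fun setT u -> measurable_fun setT (transfer u).
Proof.
move=> mu; apply: measurable_funM => //; apply: measurable_funD;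
  by apply: measurableT_comp => //; exact: measurable_expand.
Qed.

Lemma cvg_transfer (u_ : nat -> R -> R) (u : R -> R) :
  (forall x, u_ n x @[n --> \oo] --> u x) ->
  forall x, transfer (u_ n) x @[n --> \oo] --> transfer u x.
Proof.
move=> uu x; apply: cvgM; first exact: cvg_cst.
by apply: cvgD; exact: uu.
Qed.

Lemma integral_transfer (u : R -> R) (B : set R) :
  measurable B -> measurable_fun setT u -> (forall x, 0 <= u x) ->
  (\int[leb]_(x in B) (transfer u x)%:E =
   2^-1%:E * (\int[leb]_(x in contract false @^-1` B) (u x)%:E +
              \int[leb]_(x in contract true @^-1` B) (u x)%:E))%E.
Proof.
move=> mB mu u0.
have mue i : measurable_fun B (fun x => (u (expand i x))%:E).
  apply/measurable_EFinP; apply: measurable_funTS.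
  by apply: measurableT_comp => //; exact: measurable_expand.
rewrite /transfer; under eq_integral do rewrite EFinM EFinD.
rewrite ge0_integralZl//; last first.
- by rewrite lee_fin divr_ge0// ltW.
- by move=> x _; rewrite adde_ge0// lee_fin.
- by apply: emeasurable_funD; exact: mue.
rewrite ge0_integralD//; do ?[by move=> x _; rewrite lee_fin|exact: mue].
rewrite !integral_expand// -ge0_muleDr; try by apply: integral_ge0 => x _; rewrite lee_fin.
by rewrite muleA -EFinM; congr (_%:E * _)%E; field.
Qed.

Lemma integral_transferT (u : R -> R) : measurable_fun setT u -> (forall x, 0 <= u x) ->
  (\int[leb]_x (transfer u x)%:E = \int[leb]_x (u x)%:E)%E.
Proof.
move=> mu u0; rewrite integral_transfer// !preimage_setT.
have i0 : (0 <= \int[leb]_x (u x)%:E)%E by apply: integral_ge0 => x _; rewrite lee_fin.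
rewrite ge0_muleDr// -ge0_muleDl ?lee_fin ?invr_ge0// -EFinD.
by rewrite (_ : _ + _ = 1 :> R) ?mul1e//; field.
Qed.

(** The least cost of a covering of the expansions of [x] by words of length at
    most [k]: either the empty word is used, at cost [1], or the covering splits
    according to the first digit. *)
Fixpoint cover_cost (k : nat) (x : R) : R :=
  if k is k'.+1 then Num.min (\1_I x) (transfer (cover_cost k') x) else \1_I x.

Lemma cover_cost_ge0 k x : 0 <= cover_cost k x.
Proof.
elim: k x => [|k IH] x //=.
by rewrite le_min transfer_ge0// andbT.
Qed.

Lemma cover_cost_indic k x : cover_cost k x <= \1_I x.
Proof. by case: k => //= k; rewrite ge_min lexx. Qed.

Lemma cover_cost_decr x : nonincreasing_seq (cover_cost ^~ x).
Proof.
apply/nonincreasing_seqP => n; elim: n x => [|n IH] x; first by rewrite /= ge_min lexx.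
by rewrite [leLHS]/= [leRHS]/= le_min !ge_min lexx/= le_transfer// orbT.
Qed.

Lemma measurable_cover_cost k : measurable_fun setT (cover_cost k).
Proof.
elim: k => [|k IH] /=; first by apply: measurable_indic; exact: measurable_I.
apply: measurable_minr; last exact: measurable_transfer.
by apply: measurable_indic; exact: measurable_I.
Qed.

Definition limit_cost (x : R) : R := limn (cover_cost ^~ x).

Lemma cvg_limit_cost x : cover_cost n x @[n --> \oo] --> limit_cost x.
Proof.
apply: nonincreasing_is_cvgn; first exact: cover_cost_decr.
by exists 0 => _ [n _ <-]; exact: cover_cost_ge0.
Qed.

Lemma limit_cost_le k x : limit_cost x <= cover_cost k x.
Proof.
apply: nonincreasing_cvgn_ge; first exact: cover_cost_decr.
exact: cvg_limit_cost.
Qed.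

Lemma limit_cost_ge0 x : 0 <= limit_cost x.
Proof.
apply: limr_ge; first exact: cvg_limit_cost.
by apply: nearW => n; exact: cover_cost_ge0.
Qed.

Lemma limit_cost_indic x : limit_cost x <= \1_I x.
Proof. exact: limit_cost_le 0%N x. Qed.

Lemma limit_cost_le1 x : limit_cost x <= 1.
Proof. by apply: le_trans (limit_cost_indic x) _; rewrite indicE lern1 leq_b1. Qed.

Lemma limit_cost_gt0_I x : 0 < limit_cost x -> I x.
Proof.
move=> /lt_le_trans/(_ (limit_cost_indic x)); rewrite indicE.
by case: (boolP (x \in I)) => [/set_mem//|_]; rewrite ltxx.
Qed.

Lemma measurable_limit_cost : measurable_fun setT limit_cost.
Proof.
apply: (@measurable_fun_cvg _ _ _ _ cover_cost) => [m|x _].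
  exact: measurable_cover_cost.
exact: cvg_limit_cost.
Qed.

Lemma limit_cost_le_transfer x : limit_cost x <= transfer limit_cost x.
Proof.
have cv : transfer (cover_cost n) x @[n --> \oo] --> transfer limit_cost x.
  by apply: cvg_transfer => y; exact: cvg_limit_cost.
rewrite -(cvg_lim _ cv)//; apply: limr_ge; first by apply/cvg_ex; eexists; exact: cv.
apply: nearW => n; apply: le_trans (limit_cost_le n.+1 x) _.
by rewrite /= ge_min lexx orbT.
Qed.

Lemma iter_transfer_ge0 n u : (forall x, 0 <= u x) -> forall x, 0 <= iter n transfer u x.
Proof. by move=> u0; elim: n => //= n IH; exact: transfer_ge0. Qed.

Lemma measurable_iter_transfer n (u : R -> R) :
  measurable_fun setT u -> measurable_fun setT (iter n transfer u).
Proof. by move=> mu; elim: n => //= n IH; exact: measurable_transfer. Qed.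

Lemma cvg_iter_transfer n x :
  iter n transfer (cover_cost k) x @[k --> \oo] --> iter n transfer limit_cost x.
Proof.
elim: n x => [|n IH] x; first exact: cvg_limit_cost.
rewrite iterS; exact: (@cvg_transfer (fun k => iter n transfer (cover_cost k)) _ IH).
Qed.

Lemma limit_cost_le_iter n x : limit_cost x <= iter n transfer limit_cost x.
Proof.
elim: n x => //= n IH x; apply: le_trans (limit_cost_le_transfer x) _.
exact: le_transfer.
Qed.

Lemma integral_iter_transfer n :
  (\int[leb]_x (iter n transfer limit_cost x)%:E = \int[leb]_x (limit_cost x)%:E)%E.
Proof.
elim: n => //= n <-; rewrite integral_transferT//.
  by apply: measurable_iter_transfer; exact: measurable_limit_cost.
by apply: iter_transfer_ge0; exact: limit_cost_ge0.
Qed.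

Lemma integral_limit_cost_fin : (\int[leb]_x (limit_cost x)%:E)%E \is a fin_num.
Proof.
rewrite ge0_fin_numE; last by apply: integral_ge0 => x _; rewrite lee_fin limit_cost_ge0.
apply: (@le_lt_trans _ _ (\int[leb]_x (\1_I x)%:E)%E).
  apply: ge0_le_integral => //.
  - by move=> x _; rewrite lee_fin limit_cost_ge0.
  - by apply/measurable_EFinP; exact: measurable_limit_cost.
  - by apply/measurable_EFinP; apply: measurable_indic; exact: measurable_I.
  - by move=> x _; rewrite lee_fin limit_cost_indic.
rewrite integral_indic//; last exact: measurable_I.
by rewrite setIT; change (leb I < +oo)%E; rewrite lebesgue_I ltry.
Qed.

Lemma eq_of_integral_eq (u v : R -> R) :
  measurable_fun setT u -> measurable_fun setT v ->
  (forall x, 0 <= u x <= v x) ->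
  (\int[leb]_x (u x)%:E \is a fin_num)%E ->
  (\int[leb]_x (v x)%:E = \int[leb]_x (u x)%:E)%E ->
  \forall x \ae leb, v x = u x.
Proof.
move=> mu mv uv fin vu.
have u0 x : 0 <= u x by case/andP: (uv x).
have uvx x : u x <= v x by case/andP: (uv x).
have mvu : measurable_fun setT (fun x => (v x - u x)%:E).
  exact/measurable_EFinP/measurable_funB.
have dec : (\int[leb]_x (v x)%:E = \int[leb]_x (u x)%:E + \int[leb]_x (v x - u x)%:E)%E.
  rewrite -ge0_integralD//.
  - by apply: eq_integral => x _; rewrite -EFinD addrC subrK.
  - by move=> x _; rewrite lee_fin.
  - exact/measurable_EFinP.
  - by move=> x _; rewrite lee_fin subr_ge0.
have diff0 : (\int[leb]_x (v x - u x)%:E = 0)%E.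
  move: dec fin; rewrite vu; case: (\int[leb]_x (u x)%:E)%E => // r.
  case: (\int[leb]_x (v x - u x)%:E)%E => //= s [] /eqP.
  by rewrite addrC -subr_eq subrr => /eqP <-.
have : (\int[leb]_x `|(v x - u x)%:E| = 0)%E.
  by under eq_integral do rewrite gee0_abs ?lee_fin ?subr_ge0//.
move=> /(ae_eq_integral_abs leb measurableT mvu) [N [mN N0 sN]].
exists N; split => // x /= xN; apply: sN => /=.
by move/(_ Logic.I) => -[] /eqP; rewrite subr_eq0 => /eqP.
Qed.

(** The inequality [limit_cost <= iter n transfer limit_cost] is between functions
    with the same finite integral. *)
Lemma limit_cost_invariant :
  \forall x \ae leb, forall n, iter n transfer limit_cost x = limit_cost x.
Proof.
apply: ae_foralln => n; apply: eq_of_integral_eq.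
- exact: measurable_limit_cost.
- by apply: measurable_iter_transfer; exact: measurable_limit_cost.
- by move=> x; rewrite limit_cost_ge0 limit_cost_le_iter.
- exact: integral_limit_cost_fin.
- exact: integral_iter_transfer.
Qed.

End Transfer.

(** * The Hausdorff measure of the set of expansions *)

Lemma nneseries_term_le {R : realType} (f : nat -> \bar R) i :
  (forall j, 0 <= f j)%E -> (f i <= \sum_(j <oo) f j)%E.
Proof. by move=> f0; rewrite (nneseriesD1 (n := i))// leeDl// nneseries_ge0. Qed.

Section ExpansionMeasure.
Context {R : realType}.
Variable beta : R.
Hypothesis hbeta : 1 < beta < 2.

Let t : R := ln (2 / beta) / ln 2.
Local Notation leb := (@lebesgue_measure R).
Local Notation H := (hausdorff_measure (@seq_dist R) t).
Local Notation E := (beta_expansions beta).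
Local Notation I := (beta_interval beta).
Local Notation expand := (expand beta).
Local Notation transfer := (transfer beta).
Local Notation limit_cost := (limit_cost beta).
Local Notation cover_cost := (cover_cost beta).

Let q_gt0 : 0 < beta / 2. Proof. by case/andP: (ratio_itv hbeta). Qed.

Definition covers (L : seq (seq bool)) (A : set Sigma) :=
  A `<=` [set a | exists2 w, w \in L & cylinder w a].

Lemma covers_split x (L0 L1 : seq (seq bool)) :
  covers L0 (E (expand false x)) -> covers L1 (E (expand true x)) ->
  covers (map (cons false) L0 ++ map (cons true) L1) (E x).
Proof.
move=> cov0 cov1 a /(beta_expansionsS hbeta); case a0 : (a 0%N).
- move/cov1 => [w wL wa]; exists (true :: w); last exact/cylinder_cons.
  by rewrite mem_cat map_f ?orbT.
- move/cov0 => [w wL wa]; exists (false :: w); last exact/cylinder_cons.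
  by rewrite mem_cat map_f.
Qed.

Lemma cost_split (L0 L1 : seq (seq bool)) :
  \sum_(w <- map (cons false) L0 ++ map (cons true) L1) (beta / 2) ^+ size w =
  beta / 2 * (\sum_(w <- L0) (beta / 2) ^+ size w + \sum_(w <- L1) (beta / 2) ^+ size w).
Proof.
by rewrite big_cat !big_map/= mulrDr !mulr_sumr; congr (_ + _);
  apply: eq_bigr => w _; rewrite exprS.
Qed.

Lemma cover_cost_list k x : exists2 L, covers L (E x) &
  \sum_(w <- L) (beta / 2) ^+ size w = cover_cost k x.
Proof.
have trivial_cover y : exists2 L, covers L (E y) &
    \sum_(w <- L) (beta / 2) ^+ size w = \1_I y.
  rewrite indicE; have [yI|yI] := boolP (y \in I).
    exists [:: [::]]; last by rewrite big_seq1.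
    by move=> a _; exists [::]; rewrite ?mem_head// cylinder_nil.
  exists [::]; last by rewrite big_nil.
  suff -> : E y = set0 by move=> a.
  by apply: (beta_expansions_out hbeta) => yI'; move/negP : yI; apply; rewrite inE.
elim: k x => [|k IH] x; first exact: trivial_cover.
rewrite /=; case: leP => _; first exact: trivial_cover.
have [L0 cov0 cost0] := IH (expand false x).
have [L1 cov1 cost1] := IH (expand true x).
exists (map (cons false) L0 ++ map (cons true) L1); first exact: covers_split.
by rewrite cost_split cost0 cost1.
Qed.

Lemma iter_transfer_list n k x : exists2 L, covers L (E x) &
  all (fun w => n <= size w)%N L /\
  \sum_(w <- L) (beta / 2) ^+ size w = iter n transfer (cover_cost k) x.
Proof.
elim: n x => [|n IH] x.
  have [L covL costL] := cover_cost_list k x.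
  by exists L => //; split => //; exact/allP.
have [L0 cov0 [n0 cost0]] := IH (expand false x).
have [L1 cov1 [n1 cost1]] := IH (expand true x).
exists (map (cons false) L0 ++ map (cons true) L1); first exact: covers_split.
split; last by rewrite cost_split cost0 cost1.
by rewrite all_cat !all_map; apply/andP; split.
Qed.

(** [iter n transfer (cover_cost k) x] is the cost of a covering by words of length
    at least [n], that is, at scale [2 ^- n]. *)
Lemma hausdorff_expansions_le x (y : R) :
  (forall n, iter n transfer limit_cost x <= y) -> (H (E x) <= y%:E)%E.
Proof.
move=> ny; apply: ge_ereal_sup => _ [e /= e0 <-].
have [n ne] : exists n, 2 ^- n <= e.
  have : 2^-1 ^+ n @[n --> \oo] --> (0 : R).
    by apply: cvg_expr; rewrite gtr0_norm ?invr_gt0// invf_lt1 ?ltr1n.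
  move=> /cvgrPdist_lt/(_ _ e0)[n _ /(_ n (leqnn n))] /=.
  rewrite sub0r normrN ger0_norm ?exprn_ge0// exprVn => /ltW ?.
  by exists n.
apply: le_trans (hausdorff_premeasure_anti seq_dist t (E x) ne) _.
apply: (@le_trans _ _ (iter n transfer limit_cost x)%:E); last by rewrite lee_fin.
have cvx : iter n transfer (cover_cost k) x @[k --> \oo] --> iter n transfer limit_cost x.
  exact: cvg_iter_transfer.
have prek k : (hausdorff_premeasure seq_dist t (2 ^- n) (E x) <=
    (iter n transfer (cover_cost k) x)%:E)%E.
  have [L covL [nL <-]] := iter_transfer_list n k x.
  exact: premeasure_le_list.
have fin : hausdorff_premeasure seq_dist t (2 ^- n) (E x) \is a fin_num.
  rewrite ge0_fin_numE; first exact: le_lt_trans (prek 0%N) (ltry _).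
  exact: hausdorff_premeasure_ge0.
rewrite -(fineK fin) lee_fin -(cvg_lim _ cvx)//.
apply: limr_ge; first by apply/cvg_ex; eexists; exact: cvx.
by apply: nearW => k; rewrite -lee_fin fineK.
Qed.

Definition after_digit (b : bool) (o : option (seq bool)) : option (seq bool) :=
  if o is Some (b' :: w) then if b' == b then Some w else None else None.

Lemma cost_after_digit o : o <> Some [::] ->
  cost beta o = beta / 2 * (cost beta (after_digit false o) + cost beta (after_digit true o)).
Proof.
case: o => [[|[] w]|] //= _; rewrite ?eqxx/= ?addr0 ?add0r ?mulr0//.
- by rewrite exprS.
- by rewrite exprS.
Qed.

(** A point together with a covering that is too cheap for it; the first component
    moves along an orbit while the covering is restricted to the cylinders of the
    digits already chosen. *)
Definition underpaid (p : R * (nat -> option (seq bool))) : Prop :=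
  (\sum_(i <oo) (cost beta (p.2 i))%:E < (limit_cost p.1)%:E)%E.

(** A covering containing the empty word costs at least [1], so an underpaid one
    splits according to first digits, and [limit_cost_le_transfer] says that one of
    the two halves is underpaid as well. *)
Lemma underpaid_step p : underpaid p ->
  exists b, underpaid (expand b p.1, after_digit b \o p.2).
Proof.
case: p => y W; rewrite /underpaid/= => bad.
have cost0 o : (0 <= (cost beta o)%:E)%E by rewrite lee_fin cost_ge0.
have Wnil i : W i <> Some [::].
  move=> Wi; move: bad; rewrite ltNge => /negP; apply.
  apply: (@le_trans _ _ (cost beta (W i))%:E).
    by rewrite Wi /= lee_fin limit_cost_le1.
  exact: (nneseries_term_le (f := fun i => (cost beta (W i))%:E)).
apply: contrapT; rewrite -forallNE => good.
have {}good b : ((limit_cost (expand b y))%:E <=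
    \sum_(i <oo) (cost beta (after_digit b (W i)))%:E)%E.
  by rewrite leNgt; apply/negP; exact: good.
move: bad; rewrite ltNge => /negP; apply.
apply: (@le_trans _ _ (transfer limit_cost y)%:E).
  by rewrite lee_fin limit_cost_le_transfer.
rewrite (eq_eseriesr (fun i _ => congr1 EFin (cost_after_digit (Wnil i)))).
under eq_eseriesr do rewrite EFinM EFinD.
rewrite nneseriesZl; last by move=> i _; rewrite adde_ge0.
rewrite nneseriesD// transferE EFinM EFinD lee_pmul2l//.
by apply: leeD; exact: good.
Qed.

(** A covering of total cost less than [limit_cost x] would leave, digit after
    digit, an underpaid half; the branch so obtained is an expansion of [x]
    that no cylinder of the covering contains. *)
Lemma limit_cost_le_cover x (W : nat -> option (seq bool)) :
  E x `<=` \bigcup_i cyl_of (W i) ->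
  ((limit_cost x)%:E <= \sum_(i <oo) (cost beta (W i))%:E)%E.
Proof.
move=> cov; rewrite leNgt; apply/negP => bad0.
pose S := {p | underpaid p}.
have [digit_of nextP] := choice (fun s : S => underpaid_step (projT2 s)).
pose next (s : S) : S := exist _ _ (nextP s).
pose s n : S := iter n next (exist _ (x, W) bad0).
pose a : Sigma := fun n => digit_of (s n).
have projx : beta_proj beta a = x.
  apply: (beta_proj_unique hbeta (y := fun n => (projT1 (s n)).1)) => [n|n].
    have /limit_cost_gt0_I : 0 < limit_cost (projT1 (s n)).1.
      rewrite -lte_fin; apply: le_lt_trans (projT2 (s n)).
      by apply: nneseries_ge0 => i _ _; rewrite lee_fin cost_ge0.
    by move=> /(_ hbeta); rewrite /beta_interval/= in_itv.
  by rewrite /s iterS.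
have [i _] := cov _ projx.
suff no w n : (projT1 (s n)).2 i = Some w ->
    ~ (forall j, (j < size w)%N -> a (n + j)%N = nth false w j).
  by case Wi : (W i) => [w|//] wa; exact: (no w 0%N).
elim: w n => [|b w IH] n wn wa.
  have := projT2 (s n); rewrite /underpaid ltNge => /negP; apply.
  apply: (@le_trans _ _ (cost beta ((projT1 (s n)).2 i))%:E).
    by rewrite wn /= lee_fin limit_cost_le1.
  apply: (nneseries_term_le (f := fun i => (cost beta ((projT1 (s n)).2 i))%:E)) => j.
  by rewrite lee_fin cost_ge0.
apply: (IH n.+1) => [|j jw]; last by rewrite addSnnS (wa j.+1).
have anb : digit_of (s n) = b by rewrite -[b]/(nth false (b :: w) 0) -wa// addn0.
by rewrite /s iterS -/(s n)/= wn/= anb eqxx.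
Qed.

Lemma limit_cost_le_hausdorff x : ((limit_cost x)%:E <= H (E x))%E.
Proof. apply: (le_hausdorff_cyl hbeta); exact: limit_cost_le_cover. Qed.

Lemma hausdorff_expansions : \forall x \ae leb, H (E x) = (limit_cost x)%:E.
Proof.
apply: (@filterS _ _ (ae_filter_ringOfSetsType leb) _ _ _ (limit_cost_invariant hbeta)).
move=> x inv.
apply/eqP; rewrite eq_le limit_cost_le_hausdorff andbT.
by apply: hausdorff_expansions_le => n; rewrite inv.
Qed.

End ExpansionMeasure.

(** * Self-similar measures on the line *)

Section SelfSimilar.
Context {R : realType}.
Variable beta : R.
Hypothesis hbeta : 1 < beta < 2.

Let beta_gt1 : 1 < beta. Proof. by case/andP: hbeta. Qed.
Let beta_gt0 : 0 < beta. Proof. exact: lt_trans beta_gt1. Qed.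
Let beta_neq0 : beta != 0. Proof. by rewrite gt_eqF. Qed.

Local Notation leb := (@lebesgue_measure R).
Local Notation expand := (expand beta).
Local Notation contract := (contract beta).
Local Notation I := (beta_interval beta).
Local Notation len := ((beta - 1)^-1).
Local Notation transfer := (transfer beta).
Local Notation limit_cost := (limit_cost beta).
Local Notation cover_cost := (cover_cost beta).
Local Notation RM := (measurableTypeR R).

Definition selfsimilar (mu : set R -> \bar R) := forall B : set R, measurable B ->
  mu B = (2^-1%:E * (mu (contract false @^-1` B) + mu (contract true @^-1` B)))%E.

Lemma contract_ray i (y : R) : contract i @^-1` `]-oo, y[%classic = `]-oo, expand i y[%classic.
Proof.
apply/seteqP; split => x /=; rewrite !in_itv/= contractE expandE;
  by rewrite ltr_pdivrMr// ltrBrDr mulrC.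
Qed.

Lemma measure_setT_eq (mu : {measure set RM -> \bar R}) (B : set R) : measurable B ->
  mu (~` I) = 0%E -> I `<=` B -> mu setT = mu B.
Proof.
move=> mB mu0 IB; have mC := measurableC mB.
rewrite -(setvU B) measureU//; last by rewrite setICl.
rewrite [X in (X + _)%E](_ : _ = 0%E) ?add0e//; apply/eqP; rewrite eq_le measure_ge0 andbT.
rewrite -mu0; apply: le_measure; rewrite ?inE//.
- by apply: measurableC; exact: measurable_I.
- exact: subsetC.
Qed.

(** The comparison holds trivially when the half-lines are shifted by the length of
    [I], and each use of self-similarity divides the shift by [beta]. *)
Lemma selfsimilar_ray_le (mu1 mu2 : {measure set RM -> \bar R}) :
  selfsimilar mu1 -> selfsimilar mu2 -> mu1 (~` I) = 0%E -> mu2 (~` I) = 0%E ->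
  (mu1 setT <= mu2 setT)%E ->
  forall y : R, (mu1 `]-oo, y[%classic <= mu2 `]-oo, y[%classic)%E.
Proof.
move=> ss1 ss2 out1 out2 mass y.
have step n : forall z : R,
    (mu1 `]-oo, (z - len * beta ^- n)%R[%classic <= mu2 `]-oo, z[%classic)%E.
  elim: n => [|n IH] z.
    rewrite expr0 invr1 mulr1; have [zlen|lenz] := leP z len.
      rewrite (_ : mu1 _ = 0%E) ?measure_ge0//.
      apply/eqP; rewrite eq_le measure_ge0 andbT -out1.
      apply: le_measure; rewrite ?inE; first exact: measurable_itv.
        by apply: measurableC; exact: measurable_I.
      move=> x; rewrite /beta_interval/= !in_itv/= => xz /andP[x0 _].
      by move: xz; apply/negP; rewrite -leNgt (le_trans _ x0)// subr_le0.
    apply: (@le_trans _ _ (mu1 setT)).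
      by apply: le_measure; rewrite ?inE//; exact: measurable_itv.
    apply: le_trans mass _; rewrite (measure_setT_eq _ out2 (B := `]-oo, z[%classic))//.
    move=> x; rewrite /beta_interval/= !in_itv/= => /andP[_ xlen].
    exact: le_lt_trans lenz.
  rewrite (ss1 _ (measurable_itv _)) (ss2 _ (measurable_itv _)).
  rewrite !contract_ray lee_pmul2l ?lte_fin ?invr_gt0//.
  have e i : expand i (z - len * beta ^- n.+1) = expand i z - len * beta ^- n.
    by rewrite !expandE mulrBr addrAC [beta ^+ n.+1]exprS invfM [in beta * (len * _)]mulrCA mulVKf.
  by rewrite !e; apply: leeD; exact: IH.
pose F n := `]-oo, (y - len * beta ^- n)[%classic : set R.
have mF n : measurable (F n : set RM) by exact: measurable_itv.
have FE : \bigcup_n F n = `]-oo, y[%classic.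
  apply/seteqP; split=> [x [n _]|x]; rewrite /F/= !in_itv/=.
    move=> /lt_le_trans; apply; rewrite gerBl mulr_ge0// invr_ge0.
      by rewrite subr_ge0 ltW.
    by rewrite exprn_ge0 ?ltW.
  move=> xy; have : len * beta^-1 ^+ n @[n --> \oo] --> len * 0.
    apply: cvgM; first exact: cvg_cst.
    by apply: cvg_expr; rewrite gtr0_norm ?invr_gt0// invf_lt1.
  rewrite mulr0 => /cvgrPdist_lt; have d0 : 0 < y - x by rewrite subr_gt0.
  move=> /(_ _ d0)[n _ /(_ n (leqnn n))] /=; rewrite sub0r normrN exprVn => dist.
  exists n => //=; rewrite in_itv/= ltrBrDr -ltrBrDl.
  exact: le_lt_trans (ler_norm _) dist.
have : mu1 (F n) @[n --> \oo] --> mu1 (\bigcup_n F n).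
  apply: nondecreasing_cvg_mu => //; first exact: bigcupT_measurable.
  move=> n k nk; apply/subsetPset => x; rewrite /F/= !in_itv/= => /lt_le_trans; apply.
  rewrite lerD2l lerN2 ler_wpM2l//; first by rewrite invr_ge0 subr_ge0 ltW.
  by rewrite lef_pV2 ?posrE ?exprn_gt0// ler_eXn2l.
rewrite FE => cv; rewrite -(cvg_lim _ cv)//.
apply: lime_le; first by apply/cvg_ex; eexists; exact: cv.
by apply: nearW => n; exact: step.
Qed.

Lemma selfsimilar_unique (mu1 mu2 : {measure set RM -> \bar R}) :
  selfsimilar mu1 -> selfsimilar mu2 -> mu1 (~` I) = 0%E -> mu2 (~` I) = 0%E ->
  mu1 setT = mu2 setT -> (mu1 setT < +oo)%E ->
  forall B : set R, measurable B -> mu1 B = mu2 B.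
Proof.
move=> ss1 ss2 out1 out2 mass fin.
apply: (@measure_unique _ _ RM (@RGenInftyO.G R) (fun n => `]-oo, n%:R[%classic)).
- exact: RGenInftyO.measurableE.
- move=> _ _ [x ->] [y ->]; exists (Num.min x y); apply/seteqP.
  by split=> z /=; rewrite !in_itv/= lt_min ; [case=> -> ->|move/andP].
- by move=> i; exists i%:R.
- apply/seteqP; split => // x _; exists (Num.bound `|x|) => //=.
  rewrite in_itv/=; apply: le_lt_trans (ler_norm x) _.
  exact: archi_boundP.
- move=> _ [y ->]; apply/eqP; rewrite eq_le.
  by rewrite selfsimilar_ray_le ?mass// selfsimilar_ray_le ?mass.
- move=> k; apply: le_lt_trans fin.
  by apply: le_measure; rewrite ?inE//; exact: measurable_itv.
Qed.

Lemma density_measure (u : R -> R) : measurable_fun setT u -> (forall x, 0 <= u x) ->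
  {mu : {measure set RM -> \bar R} |
    forall B : set R, mu B = (\int[leb]_(x in B) (u x)%:E)%E}.
Proof.
move=> mu u0; pose D (B : set RM) : \bar R := (\int[leb]_(x in B) (u x)%:E)%E.
have D0 : D set0 = 0%E by exact: integral_set0.
have Dge0 B : (0 <= D B)%E by apply: integral_ge0 => x _; rewrite lee_fin.
have Dadd : semi_sigma_additive D.
  move=> /= F mF tF mUF; apply: cvg_toP.
    by apply: ereal_nondecreasing_is_cvgn => m n mn; apply: lee_sum_nneg_natr.
  rewrite /D ge0_integral_bigcup//=.
  - by apply/measurable_EFinP; exact: measurable_funTS.
  - by move=> x _; rewrite lee_fin.
pose M := isMeasure.Build _ RM _ D D0 Dge0 Dadd.
by exists (HB.pack D M : {measure set RM -> \bar R}).
Qed.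

(** Integrated form of [transfer limit_cost = limit_cost]. *)
Lemma selfsimilar_limit_cost : selfsimilar (fun B => \int[leb]_(x in B) (limit_cost x)%:E)%E.
Proof.
move=> B mB; rewrite -(integral_transfer hbeta)//.
- apply: ae_eq_integral => //.
  + apply/measurable_EFinP; apply: measurable_funTS; exact: measurable_limit_cost.
  + apply/measurable_EFinP; apply: measurable_funTS.
    by apply: measurable_transfer; exact: measurable_limit_cost.
  + apply: (@filterS _ _ (ae_filter_ringOfSetsType leb) _ _ _ (limit_cost_invariant hbeta)).
    by move=> x inv _; rewrite -[in LHS](inv 1%N).
- exact: measurable_limit_cost.
- exact: limit_cost_ge0.
Qed.

Lemma limit_cost_out : (\int[leb]_(x in ~` I) (limit_cost x)%:E = 0)%E.
Proof.
rewrite (eq_integral (cst 0%E)) ?integral0// => x; rewrite inE => xI.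
congr EFin; apply/eqP; rewrite eq_le limit_cost_ge0// andbT leNgt; apply/negP.
by move/(limit_cost_gt0_I hbeta).
Qed.

Section Mass.
Variable m : probability Sigma R.
Hypothesis hm : is_bernoulli m.

(** The Bernoulli convolution as a measure for the measurable structure of the line
    that carries Lebesgue measure; [proj_measure] is the same set function for the
    default structure of [R]. *)
Definition image_measure : {measure set RM -> \bar R}.
Proof.
refine (pushforward m (beta_proj beta : _ -> RM) : {measure set RM -> \bar R}).
exact: measurable_beta_proj.
Defined.

Lemma image_measureE (B : set R) : image_measure B = bernoulli_convolution beta m B.
Proof. by []. Qed.

Local Notation nu := image_measure.

Lemma image_measureT : nu setT = 1%E.
Proof.
rewrite image_measureE /bernoulli_convolution /pushforward preimage_setT.
exact: probability_setT.
Qed.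

Lemma image_measure_out : nu (~` I) = 0%E.
Proof.
rewrite image_measureE /bernoulli_convolution /pushforward.
rewrite (_ : _ @^-1` _ = set0) ?measure0//; apply/seteqP; split => // a; apply.
by rewrite /beta_interval/= in_itv/= beta_proj_itv.
Qed.

Lemma selfsimilar_image_measure : selfsimilar nu.
Proof.
move=> B mB; rewrite !image_measureE /bernoulli_convolution /pushforward.
have mpB := measurable_preimage_proj hbeta mB.
have split01 : beta_proj beta @^-1` B =
    (cylinder [:: false] `&` beta_proj beta @^-1` B) `|`
    (cylinder [:: true] `&` beta_proj beta @^-1` B).
  rewrite -setIUl (_ : _ `|` _ = setT) ?setTI//.
  apply/seteqP; split => // a _; case a0 : (a 0%N); [right|left];
    by apply/cylinder_cons; split => //; rewrite cylinder_nil.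
rewrite {1}split01 measureU.
- have head i : m (cylinder [:: i] `&` beta_proj beta @^-1` B) =
      (2^-1%:E * m (beta_proj beta @^-1` (contract i @^-1` B)))%E.
    by rewrite (beta_proj_contract hbeta hm)// cylinder_nil setTI.
  by rewrite ge0_muleDr//; congr (_ + _)%E; exact: head.
- by apply: measurableI => //; exact: measurable_cylinder.
- by apply: measurableI => //; exact: measurable_cylinder.
- apply/seteqP; split => // a [[/cylinder_cons[a0 _] _] [/cylinder_cons[]]].
  by rewrite a0.
Qed.

Definition mass : R := fine (\int[leb]_x (limit_cost x)%:E).

Lemma massE : (\int[leb]_x (limit_cost x)%:E = mass%:E)%E.
Proof. by rewrite fineK// integral_limit_cost_fin. Qed.

Lemma mass_ge0 : 0 <= mass.
Proof. by apply: fine_ge0; apply: integral_ge0 => x _; rewrite lee_fin limit_cost_ge0. Qed.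

(** Both sides are self-similar, carried by [I], and of the same total mass. *)
Lemma limit_cost_density (B : set R) : measurable B ->
  (\int[leb]_(x in B) (limit_cost x)%:E = mass%:E * nu B)%E.
Proof.
move=> mB; have [mu muE] := density_measure (measurable_limit_cost hbeta) (limit_cost_ge0 hbeta).
pose k : {nonneg R} := NngNum mass_ge0.
pose mu' : {measure set RM -> \bar R} := mscale k nu.
have mu'E C : mu' C = (mass%:E * nu C)%E by [].
rewrite -muE -mu'E; apply: selfsimilar_unique => //.
- by move=> C mC; rewrite !muE; exact: selfsimilar_limit_cost.
- move=> C mC; rewrite !mu'E selfsimilar_image_measure//.
  by rewrite muleCA ge0_muleDr.
- by rewrite muE limit_cost_out.
- by rewrite mu'E image_measure_out mule0.
- by rewrite muE mu'E image_measureT mule1 massE.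
- by rewrite muE massE ltry.
Qed.

(** By induction on [k], cutting [B] according to which of the two terms of the
    minimum defining [cover_cost k.+1] is smaller: where it is the indicator, the
    hypothesis applies; where it is the transfer, self-similarity of [nu] reduces to
    [cover_cost k]. *)
Lemma nu_le_cover_cost (C : R) : 0 <= C ->
  (forall B : set R, measurable B -> (nu B <= C%:E * leb B)%E) ->
  forall k (B : set R), measurable B ->
    (nu B <= C%:E * \int[leb]_(x in B) (cover_cost k x)%:E)%E.
Proof.
move=> C0 nuC.
have base (B : set R) : measurable B ->
    (nu B <= C%:E * \int[leb]_(x in B) (\1_I x)%:E)%E.
  move=> mB; rewrite integral_indic//; last exact: measurable_I.
  have mBI : measurable (B `&` I) by apply: measurableI => //; exact: measurable_I.
  have mBC : measurable (B `&` ~` I).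
    by apply: measurableI => //; apply: measurableC; exact: measurable_I.
  have -> : nu B = nu (B `&` I).
    rewrite -[in LHS](setIT B) -(setUv I) setIUr measureU//; last first.
      by rewrite setIACA setICr setI0.
    rewrite [X in (_ + X)%E](_ : _ = 0%E) ?adde0//.
    apply/eqP; rewrite eq_le measure_ge0 andbT -image_measure_out.
    apply: le_measure; rewrite ?inE//; first by apply: measurableC; exact: measurable_I.
  by rewrite [in leRHS]setIC; exact: nuC.
elim=> [|k IH] B mB; first exact: base.
pose T := [set x | \1_I x <= transfer (cover_cost k) x].
have mt : measurable_fun setT (transfer (cover_cost k)).
  by apply: measurable_transfer; exact: measurable_cover_cost.
have mi : measurable_fun setT (\1_I : R -> R).
  by apply: measurable_indic; exact: measurable_I.
have mT : measurable (T : set RM).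
  by rewrite -[T]setTI; exact: measurable_fun_le.
have mcc : measurable_fun setT (EFin \o cover_cost k.+1 : RM -> _).
  by apply/measurable_EFinP; exact: measurable_cover_cost.
have m1 : measurable (B `&` T) by exact: measurableI.
have m2 : measurable (B `&` ~` T) by apply: measurableI => //; exact: measurableC.
have split B' : B' = (B' `&` T) `|` (B' `&` ~` T) by rewrite -setIUr setUv setIT.
have dis : (B `&` T) `&` (B `&` ~` T) = set0 by rewrite setIACA setICr setI0.
rewrite {1 2}(split B) measureU// ge0_integral_setU//; last 3 first.
- exact: measurable_funTS.
- by move=> x _; rewrite lee_fin cover_cost_ge0.
- by rewrite disj_set2E dis.
rewrite ge0_muleDr; try by apply: integral_ge0 => x _; rewrite lee_fin cover_cost_ge0.
apply: leeD.
- apply: le_trans (base _ m1) _; rewrite lee_wpmul2l ?lee_fin//.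
  rewrite le_eqVlt; apply/orP; left; apply/eqP; apply: eq_integral => x.
  by rewrite inE => -[_ xT]; congr EFin; apply/esym/min_idPl.
- apply: (@le_trans _ _ (C%:E * \int[leb]_(x in B `&` ~` T)
      (transfer (cover_cost k) x)%:E)%E); last first.
    rewrite lee_wpmul2l ?lee_fin//.
    rewrite le_eqVlt; apply/orP; left; apply/eqP; apply: eq_integral => x.
    rewrite inE => -[_ xT]; congr EFin; apply/esym/min_idPr.
    by rewrite leNgt; apply/negP => /ltW.
  rewrite (integral_transfer hbeta)//;
    [|exact: measurable_cover_cost|exact: cover_cost_ge0].
  rewrite [leLHS]selfsimilar_image_measure// muleCA lee_pmul2l ?lte_fin ?invr_gt0//.
  rewrite ge0_muleDr; try by apply: integral_ge0 => x _; rewrite lee_fin cover_cost_ge0.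
  by apply: leeD; apply: IH; exact: measurable_contract_preimage.
Qed.

Lemma cvg_integral_cover_cost :
  (\int[leb]_x (cover_cost k x)%:E @[k --> \oo] --> \int[leb]_x (limit_cost x)%:E)%E.
Proof.
have mi : measurable_fun setT (\1_I : R -> R).
  by apply: measurable_indic; exact: measurable_I.
have [|||||_ _] := @dominated_convergence _ RM R leb setT measurableT
  (fun k x => (cover_cost k x)%:E) (fun x => (limit_cost x)%:E) (fun x => (\1_I x)%:E).
- by move=> n; apply/measurable_EFinP; exact: measurable_cover_cost.
- by apply/measurable_EFinP; exact: measurable_limit_cost.
- by apply: aeW => x _; apply: cvg_EFin; [exact: nearW|exact: cvg_limit_cost].
- apply/integrableP; split; first exact/measurable_EFinP.
  under eq_integral do rewrite gee0_abs ?lee_fin//.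
  rewrite integral_indic//; last exact: measurable_I.
  by rewrite setIT; change (leb I < +oo)%E; rewrite lebesgue_I// ltry.
- apply: aeW => x n _; rewrite gee0_abs ?lee_fin ?cover_cost_ge0//.
  exact: cover_cost_indic.
exact.
Qed.

Lemma mass_gt0_of_bounded (C : R) : 0 <= C ->
  (forall B : set R, measurable B -> (nu B <= C%:E * leb B)%E) -> 0 < mass.
Proof.
move=> C0 nuC.
have cc k : (1 <= C%:E * \int[leb]_x (cover_cost k x)%:E)%E.
  by rewrite -image_measureT; exact: nu_le_cover_cost.
have cv : (C%:E * \int[leb]_x (cover_cost k x)%:E @[k --> \oo] --> C%:E * mass%:E)%E.
  rewrite -massE; apply: cvgeZl => //; exact: cvg_integral_cover_cost.
have : (1 <= C%:E * mass%:E)%E.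
  rewrite -(cvg_lim _ cv)//; apply: lime_ge.
    by apply/cvg_ex; eexists; exact: cv.
  by apply: nearW => k; exact: cc.
rewrite -EFinM lee_fin => Cm; rewrite lt_neqAle mass_ge0 andbT eq_sym.
by apply/eqP => m0; move: Cm; rewrite m0 mulr0 ler10.
Qed.

End Mass.

(** * Positivity almost everywhere *)

(** Up to a null set this is where [limit_cost] is positive; allowing all iterates
    makes the set stable under inverse branches everywhere, not only almost
    everywhere. *)
Definition charged : set R := [set x | exists n, 0 < iter n transfer limit_cost x].

Lemma measurable_charged : measurable charged.
Proof.
rewrite (_ : charged = \bigcup_n (iter n transfer limit_cost @^-1` `]0, +oo[%classic)).
  apply: bigcupT_measurable => n; rewrite -[_ @^-1` _]setTI.
  by apply: measurable_iter_transfer => //; exact: measurable_limit_cost.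
apply/seteqP; split => [x [n xn]|x [n _]]; first by exists n => //=; rewrite in_itv/= xn.
by rewrite /= in_itv/= andbT; exists n.
Qed.

Lemma charged_expand i x : charged (expand i x) -> charged x.
Proof.
move=> [n xn]; exists n.+1; rewrite iterS mulr_gt0// ?divr_gt0//.
have ge0 y : 0 <= iter n transfer limit_cost y.
  by apply: iter_transfer_ge0 => //; exact: limit_cost_ge0.
by case: i xn => xn; [exact: ltr_wpDl|exact: ltr_wpDr].
Qed.

Lemma charged_I : charged `<=` I.
Proof.
move=> x [n]; elim: n x => [|n IH] x /=; first exact: limit_cost_gt0_I.
have ge0 y : 0 <= iter n transfer limit_cost y.
  by apply: iter_transfer_ge0 => //; exact: limit_cost_ge0.
have down i : I (expand i x) -> I x.
  have len0 : (beta - 1) * len = 1 by rewrite divff// gt_eqF// subr_gt0.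
  have i01 : 0 <= (i%:R : R) <= 1 by rewrite ler0n lern1 leq_b1.
  rewrite /beta_interval/= !in_itv/= !expandE => /andP[x0 x1].
  have := len_gt0 hbeta; move: i01 len0 x0 x1.
  move: (i%:R : R) len => e l /andP[e0 e1] len0 x0 x1 l0.
  by apply/andP; split; nra.
move=> pos.
have [f0|f0] := ltP 0 (iter n transfer limit_cost (expand false x)).
  exact/(down false)/IH.
have [t0|t0] := ltP 0 (iter n transfer limit_cost (expand true x)).
  exact/(down true)/IH.
move: pos; rewrite transferE ltNge => /negP[].
apply: mulr_ge0_le0; first by rewrite divr_ge0// ltW.
by rewrite -[leRHS]addr0; exact: lerD.
Qed.

Lemma lebesgue_expand i (B : set R) : measurable B ->
  leb (expand i @^-1` B) = (beta^-1%:E * leb B)%E.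
Proof.
move=> mB; have mE : measurable (expand i @^-1` B).
  by rewrite -[_ @^-1` _]setTI; exact: measurable_expand.
rewrite -[in RHS](_ : contract i @^-1` (expand i @^-1` B) = B).
  by rewrite lebesgue_contract// muleA -EFinM mulVf// mul1e.
by apply/seteqP; split => x; rewrite /= contractK.
Qed.

(** Reading [n] digits of an expansion of [x] is an affine map that expands by
    [beta ^+ n]; [Q] is the preimage of [charged] under it. *)
Lemma zoom n x : I x -> exists2 Q : set R, measurable Q &
  [/\ Q `<=` charged, forall y, Q y -> `|y - x| <= beta ^- n * len &
      leb Q = ((beta ^- n)%:E * leb charged)%E].
Proof.
elim: n x => [|n IH] x xI.
  exists charged; first exact: measurable_charged.
  rewrite expr0 invr1 mul1e mul1r; split => // y /charged_I; move: xI.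
  rewrite /beta_interval/= !in_itv/= => /andP[x0 x1] /andP[y0 y1].
  by rewrite ler_norml; apply/andP; split; lra.
have [i iI] : exists i, I (expand i x).
  have len0 : (beta - 1) * len = 1 by rewrite divff// gt_eqF// subr_gt0.
  have b2 : beta < 2 by case/andP: hbeta.
  move: xI; rewrite /beta_interval/= in_itv/= => /andP[x0 x1].
  have [small|big] := leP (beta * x) len.
    by exists false; rewrite in_itv/= !expandE subr0 small mulr_ge0// ltW.
  exists true; rewrite in_itv/= !expandE /=.
  have := len_gt0 hbeta; move: len0 x0 x1 big.
  move: len => l len0 x0 x1 big l0; rewrite !mulr1n.
  by apply/andP; split; nra.
have [Q mQ [QP Qd Ql]] := IH _ iI.
exists (expand i @^-1` Q).
  by rewrite -[_ @^-1` _]setTI; exact: measurable_expand.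
split=> [y /QP /charged_expand //|y /Qd|].
  rewrite !expandE opprB addrA subrK -mulrBr normrM gtr0_norm//.
  by rewrite -ler_pdivlMl// mulrA -invfM -exprS.
by rewrite lebesgue_expand// Ql muleA -EFinM -invfM -exprS.
Qed.

(** By [zoom], [charged] occupies a fixed proportion of arbitrarily small balls
    around every point of [I], so no point of [I] is a density point of the
    complement. *)
Lemma ae_charged : (0 < leb charged)%E -> \forall x \ae leb, I x -> charged x.
Proof.
move=> pos.
apply: (@filterS _ _ (ae_filter_ringOfSetsType leb) _ _ _
  (lebesgue_density measurable_charged)) => x dens xI.
apply: contrapT => xP.
have l0 := len_gt0 hbeta.
have fin : leb charged \is a fin_num.
  rewrite ge0_fin_numE ?measure_ge0//; apply: (@le_lt_trans _ _ (leb I)).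
    apply: le_measure; rewrite ?inE; [exact: measurable_charged|exact: measurable_I|].
    exact: charged_I.
  by rewrite lebesgue_I// ltry.
pose p := fine (leb charged).
have p0 : 0 < p by rewrite -lte_fin fineK.
have pE : leb charged = p%:E by rewrite fineK.
have e0 : 0 < p / (4 * len) by rewrite divr_gt0// mulr_gt0.
move: dens; rewrite indicE memNset// => dens.
have near0 : nbhs (0%:R%:E : \bar R) [set y | (y < (p / (4 * len))%:E)%E].
  by apply: open_ereal_lt'; rewrite lte_fin.
have /= [d /= d0 dP] := dens _ near0.
have [n nd] : exists n, 2 * len * beta^-1 ^+ n < d.
  have : 2 * len * beta^-1 ^+ n @[n --> \oo] --> 2 * len * 0.
    apply: cvgM; first exact: cvg_cst.
    by apply: cvg_expr; rewrite gtr0_norm ?invr_gt0// invf_lt1.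
  rewrite mulr0 => /cvgrPdist_lt/(_ _ d0)[n _ /(_ n (leqnn n))] /=.
  rewrite sub0r normrN ger0_norm; first by exists n.
  by apply/ltW; rewrite mulr_gt0 ?exprn_gt0 ?invr_gt0// mulr_gt0.
(* twice the radius given by zoom, since balls are open *)
pose r := 2 * len * beta^-1 ^+ n.
have bn0 : 0 < beta ^- n by rewrite invr_gt0 exprn_gt0.
have r0 : 0 < r by rewrite /r exprVn mulr_gt0// mulr_gt0.
have : (leb (charged `&` ball x r) * (leb (ball x r))^-1 < (p / (4 * len))%:E)%E.
  by apply: dP => //=; rewrite sub0r normrN gtr0_norm.
rewrite ltNge => /negP; apply.
have [Q mQ [QP Qd Ql]] := zoom n xI.
have QB : Q `<=` charged `&` ball x r.
  move=> y Qy; split; first exact: QP.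
  rewrite /ball/= distrC; apply: le_lt_trans (Qd _ Qy) _.
  by rewrite /r exprVn; nra.
rewrite lebesgue_measure_ball; last exact: ltW.
rewrite inver mulrn_eq0/= gt_eqF//.
apply: (@le_trans _ _ (leb Q * (r *+ 2)^-1%:E)%E).
  rewrite Ql pE -!EFinM lee_fin /r exprVn -mulr_natr.
  rewrite le_eqVlt; apply/orP; left; apply/eqP; field.
  by rewrite !gt_eqF// ?exprn_gt0// subr_gt0.
rewrite lee_wpmul2r ?lee_fin ?invr_ge0 ?mulrn_wge0 ?(ltW r0)//.
apply: le_measure; rewrite ?inE//; apply: measurableI; first exact: measurable_charged.
exact: measurable_ball.
Qed.

Lemma ae_limit_cost_gt0 : 0 < mass -> \forall x \ae leb, I x -> 0 < limit_cost x.
Proof.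
move=> mass0.
have pos : (0 < leb charged)%E.
  rewrite lt_neqAle measure_ge0 andbT eq_sym; apply/eqP => c0.
  have : (\int[leb]_x (limit_cost x)%:E = 0)%E.
    rewrite (@ge0_negligible_integral _ RM R leb setT charged)//.
    - rewrite (eq_integral (cst 0%E)) ?integral0// => x; rewrite inE => -[_ xP].
      congr EFin; apply/eqP; rewrite eq_le limit_cost_ge0// andbT leNgt.
      by apply/negP => x0; apply: xP; exists 0%N.
    - exact: measurable_charged.
    - by apply/measurable_EFinP; exact: measurable_limit_cost.
    - by move=> x _; rewrite lee_fin limit_cost_ge0.
  by rewrite massE => -[] m0; move: mass0; rewrite m0 ltxx.
apply: (@filterS2 _ _ (ae_filter_ringOfSetsType leb) _ _ _ _
  (ae_charged pos) (limit_cost_invariant hbeta)) => x xP inv xI.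
by have [n] := xP xI; rewrite inv.
Qed.

End SelfSimilar.

(** * Disintegrations and the conclusion *)

Lemma ae_forall_count {R : realType} (T : countType) (P : T -> R -> Prop) :
  (forall t, \forall x \ae (@lebesgue_measure R), P t x) ->
  \forall x \ae (@lebesgue_measure R), forall t, P t x.
Proof.
move=> aeP.
have aen : \forall x \ae (@lebesgue_measure R), forall n : nat,
    if unpickle n is Some t then P t x else True.
  apply: ae_foralln => n; case: unpickle => [t|]; first exact: aeP.
  exact: aeW.
apply: (@filterS _ _ (ae_filter_ringOfSetsType (@lebesgue_measure R)) _ _ _ aen).
by move=> x xP t; have := xP (pickle t); rewrite pickleK.
Qed.

Section Disintegration.
Context {R : realType}.
Variable beta : R.
Hypothesis hbeta : 1 < beta < 2.
Variable m : probability Sigma R.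
Hypothesis hm : is_bernoulli m.

Let beta_gt1 : 1 < beta. Proof. by case/andP: hbeta. Qed.
Let beta_gt0 : 0 < beta. Proof. exact: lt_trans beta_gt1. Qed.
Let beta_neq0 : beta != 0. Proof. by rewrite gt_eqF. Qed.

Local Notation leb := (@lebesgue_measure R).
Local Notation I := (beta_interval beta).
Local Notation E := (beta_expansions beta).
Local Notation limit_cost := (limit_cost beta).
Local Notation mass := (mass beta).
Local Notation nu := (bernoulli_convolution beta m).
Local Notation RM := (measurableTypeR R).

Lemma limit_cost_densityE (B : set R) : measurable B ->
  (\int[leb]_(x in B) (limit_cost x)%:E = mass%:E * nu B)%E.
Proof. by move=> mB; rewrite (limit_cost_density hbeta hm). Qed.

Lemma limit_cost_integral_le (B : set R) : measurable B ->
  (\int[leb]_(x in B) (limit_cost x)%:E <= leb B)%E.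
Proof.
move=> mB; rewrite -[leRHS]mul1e -integral_cst//; apply: ge0_le_integral => //.
- by move=> x _; rewrite lee_fin limit_cost_ge0.
- by apply/measurable_EFinP; apply: measurable_funTS; exact: measurable_limit_cost.
- by move=> x _; rewrite lee_fin limit_cost_le1.
Qed.

(** Removing the digits of [w] one by one divides the left-hand side by [2] and
    multiplies the Lebesgue measure of the base set by [beta], until
    [limit_cost <= 1] bounds the density. *)
Lemma cylinder_proj_le w (B : set R) : measurable B ->
  (mass%:E * m (cylinder w `&` beta_proj beta @^-1` B) <=
   ((beta / 2) ^+ size w)%:E * leb B)%E.
Proof.
elim: w B => [|i w IH] B mB.
  rewrite cylinder_nil setTI expr0 mul1e.
  by rewrite -[m _]/(nu B) -limit_cost_densityE// limit_cost_integral_le.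
rewrite (beta_proj_contract hbeta hm)// muleCA.
have IHc := IH _ (measurable_contract_preimage beta i mB).
apply: (@le_trans _ _ (2^-1%:E * (((beta / 2) ^+ size w)%:E * leb (contract beta i @^-1` B)))%E).
  by rewrite lee_wpmul2l ?lee_fin ?invr_ge0.
rewrite lebesgue_contract//= !muleA -!EFinM exprS le_eqVlt; apply/orP; left.
by apply/eqP; congr (_%:E * _)%E; field.
Qed.

Variable m_ : R -> probability Sigma R.
Hypothesis dis : is_disintegration beta m m_.
Hypothesis mass0 : 0 < mass.

Lemma fibre_full : exists2 N : set R, measurable N /\ nu N = 0%E &
  forall x, I x -> ~ N x -> m_ x (E x) = 1%E.
Proof.
have [_ [N [mN N0 sN]] _] := dis.
exists N => // x xI xN; apply: contrapT => bad; apply: xN; apply: sN => /=.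
by move/(_ xI).
Qed.

Lemma limit_cost_null (N : set R) : measurable N -> nu N = 0%E ->
  \forall x \ae leb, N x -> limit_cost x = 0.
Proof.
move=> mN N0.
have mc : measurable_fun (N : set RM) (fun x => (limit_cost x)%:E).
  by apply/measurable_EFinP; apply: measurable_funTS; exact: measurable_limit_cost.
have /(ae_eq_integral_abs leb mN mc) ae0 : (\int[leb]_(x in N) `|(limit_cost x)%:E| = 0)%E.
  under eq_integral do rewrite gee0_abs ?lee_fin ?limit_cost_ge0//.
  by rewrite limit_cost_densityE// N0 mule0.
apply: (@filterS _ _ (ae_filter_ringOfSetsType leb) _ _ _ ae0) => x x0 Nx.
by have [] := x0 Nx.
Qed.

(** [B] avoids the exceptional set [N], so that [m_ x (cylinder w)] can stand for the
    measure of the part of the cylinder over [x], whose measurability in [x] is not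
    part of the definition of a disintegration. *)
Lemma disintegration_cylinder w (N B : set R) :
  (forall x, I x -> ~ N x -> m_ x (E x) = 1%E) ->
  measurable B -> B `<=` I `\` N ->
  (m (cylinder w `&` beta_proj beta @^-1` B) =
   \int[nu]_(x in I) ((\1_B x)%:E * m_ x (cylinder w)))%E.
Proof.
move=> full mB BI.
have mA : measurable (cylinder w `&` beta_proj beta @^-1` B : set Sigma).
  by apply: measurableI; [exact: measurable_cylinder|exact: measurable_preimage_proj].
have [_ _ /(_ (\1_(cylinder w `&` beta_proj beta @^-1` B)))] := dis.
have int1 : m.-integrable setT (EFin \o \1_(cylinder w `&` beta_proj beta @^-1` B)).
  apply/integrableP; split; first by apply/measurable_EFinP; exact: measurable_indic.
  under eq_integral do rewrite /= ger0_norm//.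
  by rewrite integral_indic// setIT (le_lt_trans (probability_le1 _ _)) ?ltry.
move=> /(_ int1); rewrite integral_indic// setIT => ->.
apply: (@eq_integral _ _ _ (proj_measure hbeta m)) => x; rewrite inE => xI.
rewrite integral_indic//; last exact: measurable_beta_expansions.
rewrite indicE; have [/set_mem xB|xB] := boolP (x \in B); last first.
  rewrite mul0e (_ : _ `&` _ = set0) ?measure0//.
  apply/seteqP; split => // a [[_ Ba] ax]; move/negP : xB; apply; rewrite inE.
  by move: Ba; rewrite /= ax.
rewrite mul1e.
have [_ xN] := BI _ xB.
have mE := measurable_beta_expansions hbeta x.
have mC := measurable_cylinder w.
have out0 : m_ x (~` E x) = 0%E by rewrite probability_setC// full// subee.
apply/eqP; rewrite eq_le; apply/andP; split.
  apply: le_measure; rewrite ?inE//; first exact: measurableI.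
  by move=> a [[]].
apply: (@le_trans _ _ (m_ x ((cylinder w `&` beta_proj beta @^-1` B) `&` E x `|` ~` E x))).
  apply: le_measure; rewrite ?inE//.
    by apply: measurableU; [exact: measurableI|exact: measurableC].
  move=> a wa; have [ax|] := pselect (E x a); last by right.
  by left; split => //; split => //; rewrite /= ax.
apply: le_trans (measureU2 _ _ _) _ => //; first exact: measurableI.
  exact: measurableC.
by rewrite [X in (_ + X)%E](out0 : _ = 0%E) adde0.
Qed.

(** Integrating over a base set [B], the left-hand side gives [mass] times the measure
    of the part of the cylinder above [B], which [cylinder_proj_le] bounds. *)
Lemma disintegration_bound w :
  \forall x \ae leb, I x ->
    ((limit_cost x)%:E * m_ x (cylinder w) <= ((beta / 2) ^+ size w)%:E)%E.
Proof.
have [N [mN N0] full] := fibre_full.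
have [mcyl _ _] := dis.
have mC := measurable_cylinder w.
set c := (beta / 2) ^+ size w.
have c0 : 0 < c by rewrite exprn_gt0// divr_gt0.
(* rational thresholds for the two factors make the exceptional set a countable
   union of sets on which both factors are bounded below *)
pose bad (q r : R) :=
  [set x | (I x /\ ~ N x) /\ ((q%:E <= m_ x (cylinder w))%E /\ r <= limit_cost x)].
have bad_null q r : 0 < q -> c < q * r -> measurable (bad q r) /\ leb (bad q r) = 0%E.
  move=> q0 cqr; set B := bad q r.
  have mI : measurable I by exact: measurable_I.
  have mB : measurable B.
    rewrite (_ : B = ((I `&` [set x | (q%:E <= m_ x (cylinder w))%E]) `&` ~` N) `&`
        (limit_cost @^-1` `[r, +oo[%classic)); last first.
      apply/seteqP; split=> [x [[xI xN] [xq xr]]|x [[[xI xq] xN]]];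
        by rewrite /= in_itv/= andbT.
    apply: measurableI; [apply: measurableI|].
    - exact: emeasurable_fun_c_infty (mcyl _ mC) _.
    - exact: measurableC.
    - by rewrite -[_ @^-1` _]setTI; exact: measurable_limit_cost.
  split => //.
  have low : (q%:E * nu B <= m (cylinder w `&` beta_proj beta @^-1` B))%E.
    rewrite (disintegration_cylinder w full mB); last by move=> x [].
    pose nu' := proj_measure hbeta m.
    apply: (@le_trans _ _ (\int[nu']_(x in I) (q%:E * (\1_B x)%:E))%E).
      rewrite ge0_integralZl//; last 2 first.
      - by apply/measurable_EFinP; exact: measurable_indic.
      - by rewrite lee_fin ltW.
      rewrite integral_indic// (_ : B `&` I = B)//.
      by apply/seteqP; split => [x []//|x Bx]; split => //; case: Bx => -[].
    apply: (@ge0_le_integral _ _ _ nu') => //.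
    - by move=> x _; rewrite mule_ge0// lee_fin ?ltW.
    - by apply: measurable_funeM; apply/measurable_EFinP; exact: measurable_indic.
    - apply: emeasurable_funM; last exact: mcyl.
      by apply/measurable_EFinP; exact: measurable_indic.
    - move=> x _; rewrite indicE; have [/set_mem[_ [qx _]]|_] := boolP (x \in B).
        by rewrite mule1 mul1e.
      by rewrite mule0 mul0e.
  have r0 : 0 < r by rewrite -(pmulr_rgt0 _ q0) (lt_trans c0).
  have up := cylinder_proj_le w mB.
  have dens : (r%:E * leb B <= mass%:E * nu B)%E.
    rewrite -limit_cost_densityE// -integral_cst//; apply: ge0_le_integral => //.
    - by move=> x _; rewrite lee_fin ltW.
    - by apply/measurable_EFinP; apply: measurable_funTS; exact: measurable_limit_cost.
    - by move=> x [_ [_ xr]]; rewrite lee_fin.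
  have fin : leb B \is a fin_num.
    rewrite ge0_fin_numE ?measure_ge0//; apply: (@le_lt_trans _ _ (leb I)).
      by apply: le_measure; rewrite ?inE// => x [[]].
    by rewrite lebesgue_I// ltry.
  have : (q%:E * (r%:E * leb B) <= c%:E * leb B)%E.
    apply: le_trans up.
    apply: (@le_trans _ _ (mass%:E * (q%:E * nu B))%E).
      by rewrite [leRHS]muleCA lee_wpmul2l// lee_fin ltW.
    by rewrite lee_wpmul2l// lee_fin ltW.
  have : (0 <= leb B)%E by exact: measure_ge0.
  rewrite -(fineK fin); move: (fine (leb B)) => b.
  rewrite -!EFinM !lee_fin => b0 le; congr EFin.
  by apply/eqP; rewrite eq_le b0 andbT leNgt; apply/negP => bgt0;
    move: le; rewrite mulrA ler_pM2r// leNgt cqr.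
have countable_bad : \forall x \ae leb, forall p : rat * rat,
    0 < ratr p.1 :> R -> c < ratr p.1 * ratr p.2 -> ~ bad (ratr p.1) (ratr p.2) x.
  apply: ae_forall_count => -[q r] /=.
  have [q0|q0] := ltP 0 (ratr q : R); last by apply: aeW.
  have [cqr|cqr] := ltP c (ratr q * ratr r); last by apply: aeW.
  have [mb b0] := bad_null _ _ q0 cqr.
  exists (bad (ratr q) (ratr r)); split => // x /= xb.
  by apply: contrapT => nb; apply: xb => _ _.
apply: (@filterS2 _ _ (ae_filter_ringOfSetsType leb) _ _ _ _
  countable_bad (limit_cost_null mN N0)) => x xbad xN xI.
rewrite leNgt; apply/negP.
have := measure_ge0 (m_ x) (cylinder w).
have fin : m_ x (cylinder w) \is a fin_num by exact: fin_num_measure.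
rewrite -(fineK fin); set M := fine _ => M0.
rewrite -EFinM lte_fin => cM.
have s0 : 0 < limit_cost x.
  rewrite lt_neqAle limit_cost_ge0// andbT eq_sym; apply/eqP => s0.
  by move: cM; rewrite s0 mul0r ltNge (ltW c0).
have notN : ~ N x by move=> /xN s0'; move: s0; rewrite s0' ltxx.
have [q] : exists q : rat, ratr q \in `]c / limit_cost x, M[.
  by apply: rat_in_itvoo; rewrite ltr_pdivrMr// mulrC.
rewrite in_itv/= => /andP[cq qM].
have q0 : 0 < ratr q :> R by apply: lt_trans cq; rewrite divr_gt0.
have [r] : exists r : rat, ratr r \in `]c / ratr q, limit_cost x[.
  by apply: rat_in_itvoo; rewrite ltr_pdivrMr// mulrC -ltr_pdivrMr.
rewrite in_itv/= => /andP[cr rs].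
apply: (xbad (q, r)) => //=.
  by rewrite mulrC -ltr_pdivrMr.
split => //; split; last exact: ltW.
by rewrite -(fineK fin) lee_fin ltW.
Qed.

End Disintegration.

Lemma bounded_density_le {R : realType} (nu : set R -> \bar R) :
  ac_with_bounded_density nu ->
  exists2 C : R, 0 <= C &
    forall B : set R, measurable B -> (nu B <= C%:E * lebesgue_measure B)%E.
Proof.
move=> [_ [g [mg g0 nug supg]]].
have [C C0 supC] : exists2 C : R, 0 <= C &
    (ess_sup (@lebesgue_measure R) (EFin \o g) <= C%:E)%E.
  case: (ess_sup _ _) supg => [r|//|] _; last by exists 0 => //; rewrite leNye.
  by exists (Num.max r 0); rewrite ?lee_fin le_max lexx ?orbT.
exists C => // B mB; rewrite nug// -integral_cst//.
apply: ae_ge0_le_integral => //.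
- by move=> x _; rewrite lee_fin.
- by apply/measurable_EFinP; exact: measurable_funTS.
- apply: (@filterS _ _ (ae_filter_ringOfSetsType (@lebesgue_measure R))
    _ _ _ (ess_supP supC)).
  by move=> x + _; exact.
Qed.

Theorem theorem4p1 (R : realType) (beta : R) (hbeta : 1 < beta < 2)
    (m : probability Sigma R) (hm : is_bernoulli m) :
  let t := ln (2 / beta) / ln 2 in
  let H := hausdorff_measure seq_dist t in
  let E := beta_expansions beta in
  ((\forall x \ae (@lebesgue_measure R), beta_interval beta x -> (0 < H (E x))%E)
   <-> ac_with_bounded_density (bernoulli_convolution beta m)) /\
  (ac_with_bounded_density (bernoulli_convolution beta m) ->
   forall m_ : R -> probability Sigma R, is_disintegration beta m m_ ->
   \forall x \ae (@lebesgue_measure R), beta_interval beta x ->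
     (0 < H (E x) < +oo)%E /\
     forall A : set Sigma, measurable A -> A `<=` E x ->
       m_ x A = (H A / H (E x))%E).

Proof.
move=> t H E.
pose leb := @lebesgue_measure R.
have ae2 (P Q S : R -> Prop) : (forall x, P x -> Q x -> S x) ->
    (\forall x \ae leb, P x) -> (\forall x \ae leb, Q x) -> \forall x \ae leb, S x.
  exact: (@filterS2 _ _ (ae_filter_ringOfSetsType leb)).
have pos_of_density : ac_with_bounded_density (bernoulli_convolution beta m) ->
    0 < mass beta.
  move=> /bounded_density_le [C C0 nuC].
  exact: (mass_gt0_of_bounded (hbeta := hbeta) hm C0 nuC).
split; first split.
- move=> Hpos.
  have cpos : \forall x \ae leb, beta_interval beta x -> 0 < limit_cost beta x.
    apply: (ae2 _ _ _ _ Hpos (hausdorff_expansions hbeta)) => x Hx HE xI.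
    by rewrite -lte_fin -HE; exact: Hx.
  have mass0 : 0 < mass beta.
    rewrite lt_neqAle mass_ge0// andbT eq_sym; apply/eqP => m0.
    have mc : measurable_fun (setT : set (measurableTypeR R)) (fun x => (limit_cost beta x)%:E).
      by apply/measurable_EFinP; exact: measurable_limit_cost.
    have /(ae_eq_integral_abs leb measurableT mc) ae0 :
        (\int[leb]_x `|(limit_cost beta x)%:E| = 0)%E.
      under eq_integral do rewrite gee0_abs ?lee_fin ?limit_cost_ge0//.
      by rewrite massE// m0.
    have : \forall x \ae leb, ~ beta_interval beta x.
      apply: (ae2 _ _ _ _ ae0 cpos) => x x0 cx xI.
      by move: (cx xI); have [->] := x0 Logic.I; rewrite ltxx.
    move=> [N [mN N0 sN]].
    have : (leb (beta_interval beta) <= leb N)%E.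
      apply: le_measure; rewrite ?inE//; first exact: measurable_I.
      by move=> x xI; apply: sN => /(_ xI).
    rewrite [leRHS]N0 /leb lebesgue_I// lee_fin leNgt; move/negP; apply.
    exact: len_gt0.
  have nuE (A : set R) : measurable A -> bernoulli_convolution beta m A =
      (\int[leb]_(x in A) ((mass beta)^-1 * limit_cost beta x)%:E)%E.
    move=> mA; under eq_integral do rewrite EFinM.
    rewrite ge0_integralZl//.
    + by rewrite (limit_cost_densityE hbeta hm)// muleA -EFinM mulVf ?gt_eqF// mul1e.
    + by apply/measurable_EFinP; apply: measurable_funTS; exact: measurable_limit_cost.
    + by move=> x _; rewrite lee_fin limit_cost_ge0.
    + by rewrite lee_fin invr_ge0 ltW.
  split.
    apply/null_content_dominatesP.
    move=> A mA A0.
    have := limit_cost_integral_le hbeta mA.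
    rewrite (limit_cost_densityE hbeta hm)// A0 pmule_rle0 ?lte_fin// => le0.
    by apply/eqP; rewrite eq_le le0; exact: (measure_ge0 m).
  exists (fun x => (mass beta)^-1 * limit_cost beta x); split => //.
  + by apply: measurable_funM => //; exact: measurable_limit_cost.
  + by move=> x; rewrite mulr_ge0 ?invr_ge0 ?limit_cost_ge0// ltW.
  + apply: (@le_lt_trans _ _ ((mass beta)^-1)%:E); last exact: ltry.
    apply/ess_supP; apply: aeW => x /=; rewrite lee_fin.
    by rewrite -[leRHS]mulr1 ler_wpM2l ?limit_cost_le1// invr_ge0 ltW.
- move=> /pos_of_density mass0.
  apply: (ae2 _ _ _ _ (ae_limit_cost_gt0 hbeta mass0) (hausdorff_expansions hbeta)) => x cx HE xI.
  by rewrite /H /E HE lte_fin; exact: cx.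
- move=> /pos_of_density mass0 m_ dis.
  have [N [mN N0] full] := fibre_full dis.
  have cyl := ae_forall_count (disintegration_bound hbeta hm dis mass0).
  have ae_and (P Q : R -> Prop) : (\forall x \ae leb, P x) -> (\forall x \ae leb, Q x) ->
      \forall x \ae leb, P x /\ Q x by exact: ae2.
  apply: (ae2 _ _ _ _
    (ae_and _ _ (ae_limit_cost_gt0 hbeta mass0) (hausdorff_expansions hbeta))
    (ae_and _ _ cyl (limit_cost_null hbeta hm mN N0))).
  move=> x [cx HE] [cylx xN] xI.
  have c0 := cx xI.
  rewrite /H /E HE !lte_fin c0 ltry; split => // A mA AE.
  rewrite -(measure_eq_hausdorff hbeta (mu := m_ x) (ltW c0) _ _ _ HE mA AE).
  + by rewrite muleC muleA inver gt_eqF// -EFinM mulVf ?gt_eqF// mul1e.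
  + by move=> w; exact: cylx.
  + exact: measurable_beta_expansions.
  + by apply: full => // /xN c0'; move: c0; rewrite c0' ltxx.
Qed.
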